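(* Let $E$ be a Fréchet locally convex space which does not contain a copy of $\ell_1$ and which satisfies the density condition. Then the following are equivalent: (a) $E$ is a weakly $\aleph$-space; (b) $E$ is a weakly $\aleph_0$-space; (c) the strong dual $E'$ of $E$ is separable.
   Context: A Fréchet lcs is a metrizable complete locally convex space. $E$ satisfies the density condition if every bounded subset of the strong dual $E'$ (with topology $\beta(E',E)$) is metrizable. A $k$-network in $Y$ is a family $\mathcal N$ of subsets such that whenever $K\subset U$ with $K$ compact and $U$ open, there is a finite $\mathcal F\subset\mathcal N$ with $K\subset\bigcup\mathcal F\subset U$. An $\aleph_0$-space (resp. $\aleph$-space) is a regular space with a countable (resp. $\sigma$-locally finite) $k$-network. $E$ is a weakly $\aleph$-space (resp. weakly $\aleph_0$-space) if $(E,\sigma(E,E'))$ is an $\aleph$-space (resp. $\aleph_0$-space). *)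

(* Defs.v *)
From Stdlib Require Import Reals List.
Open Scope R_scope.

Section Topo.
Variable X : Type.
Variable open : (X -> Prop) -> Prop.

Definition closed (C : X -> Prop) : Prop := open (fun x => ~ C x).

Definition regular_space : Prop :=
  (forall x : X, closed (fun y => y = x)) /\
  (forall (C : X -> Prop) (x : X), closed C -> ~ C x ->
     exists U V, open U /\ open V /\ U x /\ (forall y, C y -> V y) /\
                 (forall y, ~ (U y /\ V y))).

Definition compact (K : X -> Prop) : Prop :=
  forall (cov : (X -> Prop) -> Prop),
    (forall U, cov U -> open U) ->
    (forall x, K x -> exists U, cov U /\ U x) ->
    exists L : list (X -> Prop),
      (forall U, In U L -> cov U) /\ (forall x, K x -> exists U, In U L /\ U x).

Definition k_network (N : (X -> Prop) -> Prop) : Prop :=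
  forall K U : X -> Prop, compact K -> open U -> (forall x, K x -> U x) ->
    exists F : list (X -> Prop),
      (forall S, In S F -> N S) /\
      (forall x, K x -> exists S, In S F /\ S x) /\
      (forall S, In S F -> forall x, S x -> U x).

Definition countable_family (N : (X -> Prop) -> Prop) : Prop :=
  exists g : nat -> (X -> Prop), forall S, N S -> exists n, g n = S.

Definition locally_finite (N : (X -> Prop) -> Prop) : Prop :=
  forall x : X, exists W, open W /\ W x /\
    exists L : list (X -> Prop),
      forall S, N S -> (exists y, W y /\ S y) -> In S L.

Definition sigma_locally_finite (N : (X -> Prop) -> Prop) : Prop :=
  exists Nk : nat -> ((X -> Prop) -> Prop),
    (forall k, locally_finite (Nk k)) /\ (forall S, N S <-> exists k, Nk k S).

Definition aleph0_space : Prop :=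
  regular_space /\ exists N, k_network N /\ countable_family N.

Definition aleph_space : Prop :=
  regular_space /\ exists N, k_network N /\ sigma_locally_finite N.

Definition separable : Prop :=
  exists s : nat -> X, forall U, open U -> (exists x, U x) -> exists n, U (s n).

Definition metrizable_subset (A : X -> Prop) : Prop :=
  exists d : X -> X -> R,
    (forall x y, A x -> A y -> 0 <= d x y) /\
    (forall x y, A x -> A y -> (d x y = 0 <-> x = y)) /\
    (forall x y, A x -> A y -> d x y = d y x) /\
    (forall x y z, A x -> A y -> A z -> d x z <= d x y + d y z) /\
    (forall S : X -> Prop, (forall x, S x -> A x) ->
       ((exists U, open U /\ forall x, A x -> (S x <-> U x)) <->
        (forall x, S x -> exists r, 0 < r /\
                     forall y, A y -> d x y < r -> S y))).
End Topo.

(* ---------- Fréchet spaces (real scalars) ---------------------------------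
   A Fréchet lcs: a real vector space whose (Hausdorff, metrizable, locally
   convex) topology is given by a countable family of seminorms, complete. *)
Record Frechet := {
  vT :> Type;
  v0 : vT;
  vadd : vT -> vT -> vT;
  vopp : vT -> vT;
  vscal : R -> vT -> vT;
  vaddA : forall x y z, vadd x (vadd y z) = vadd (vadd x y) z;
  vaddC : forall x y, vadd x y = vadd y x;
  vadd0 : forall x, vadd x v0 = x;
  vaddN : forall x, vadd x (vopp x) = v0;
  vscal1 : forall x, vscal 1 x = x;
  vscalA : forall a b x, vscal a (vscal b x) = vscal (a * b) x;
  vscalDr : forall a x y, vscal a (vadd x y) = vadd (vscal a x) (vscal a y);
  vscalDl : forall a b x, vscal (a + b) x = vadd (vscal a x) (vscal b x);
  sem : nat -> vT -> R;
  sem_triangle : forall n x y, sem n (vadd x y) <= sem n x + sem n y;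
  sem_homog : forall n a x, sem n (vscal a x) = Rabs a * sem n x;
  sem_separating : forall x, (forall n, sem n x = 0) -> x = v0;
  complete : forall u : nat -> vT,
    (forall n eps, 0 < eps -> exists N, forall i j, (N <= i)%nat -> (N <= j)%nat ->
        sem n (vadd (u i) (vopp (u j))) < eps) ->
    exists l, forall n eps, 0 < eps -> exists N, forall i, (N <= i)%nat ->
        sem n (vadd (u i) (vopp l)) < eps
}.

Section FrechetDefs.
Variable E : Frechet.

Definition vsub (x y : E) : E := vadd E x (vopp E y).

Fixpoint maxsem (n : nat) (x : E) : R :=
  match n with
  | O => sem E O x
  | S m => Rmax (maxsem m x) (sem E (S m) x)
  end.

Definition E_open (U : E -> Prop) : Prop :=
  forall x, U x -> exists n eps, 0 < eps /\
    forall y, maxsem n (vsub y x) < eps -> U y.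

Definition is_linear (f : E -> R) : Prop :=
  (forall x y, f (vadd E x y) = f x + f y) /\
  (forall a x, f (vscal E a x) = a * f x).

Definition dual : Type :=
  { f : E -> R | is_linear f /\ exists n C, forall x, Rabs (f x) <= C * maxsem n x }.

Definition ev (f : dual) (x : E) : R := proj1_sig f x.

Definition E_bounded (B : E -> Prop) : Prop :=
  forall n, exists M, forall x, B x -> sem E n x <= M.

Definition strong_open (U : dual -> Prop) : Prop :=
  forall f, U f -> exists B eps, E_bounded B /\ 0 < eps /\
    forall g, (forall x, B x -> Rabs (ev g x - ev f x) <= eps) -> U g.

Definition strong_bounded (A : dual -> Prop) : Prop :=
  forall B, E_bounded B -> exists M, forall f x, A f -> B x -> Rabs (ev f x) <= M.

Definition density_condition : Prop :=
  forall A, strong_bounded A -> metrizable_subset dual strong_open A.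

Definition weak_open (U : E -> Prop) : Prop :=
  forall x, U x -> exists (L : list dual) eps, 0 < eps /\
    forall y, (forall f, In f L -> Rabs (ev f (vsub y x)) < eps) -> U y.

Definition weakly_aleph_space : Prop := aleph_space E weak_open.
Definition weakly_aleph0_space : Prop := aleph0_space E weak_open.

Definition strong_dual_separable : Prop := separable dual strong_open.

(* E contains a copy of l1: a linear topological isomorphism of l1 onto a
   subspace of E.  Elements of l1 are absolutely summable real sequences,
   ||a||_1 = l where infinite_sum (|a_n|) l. *)
Definition summable (a : nat -> R) : Prop :=
  exists l, infinite_sum (fun n => Rabs (a n)) l.

Definition contains_l1 : Prop :=
  exists T : (nat -> R) -> E,
    (forall a b, summable a -> summable b ->
       T (fun n => a n + b n) = vadd E (T a) (T b)) /\
    (forall r a, summable a -> T (fun n => r * a n) = vscal E r (T a)) /\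
    (forall n, exists C, forall a l, infinite_sum (fun k => Rabs (a k)) l ->
        sem E n (T a) <= C * l) /\
    (exists n c, 0 < c /\ forall a l, infinite_sum (fun k => Rabs (a k)) l ->
        l <= c * maxsem n (T a)).
End FrechetDefs.

(* Main.v *)
Require Import Defs.
From mathcomp Require classical_sets.
From Stdlib Require Import Reals List Lra Lia Classical ClassicalEpsilon
  FunctionalExtensionality PropExtensionality ProofIrrelevance Cantor.
Set Bullet Behavior "Strict Subproofs".
Open Scope R_scope.

(** Write [dball m] for the functionals [f] with [|f| <= m * maxsem m]; these equicontinuous
    sets exhaust the dual, and by the density condition the strong topology on each of them
    is given by countably many bounded subsets of [E].

    (a) => (c). Let [B] be bounded and let [A k] be decreasing subsets of [B], each having [0]
    in its weak closure; fix an ultrafilter [U] on [E] containing the [A k] and converging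
    weakly to [0]. Player I plays members of [U], player II picks elements [b k] of them.
    If player I can always ensure that no [f] in [dball m] has [f (b k) >= e] infinitely
    often, combining countably many strategies gives [b k] in [A k] with [b k -> 0] weakly.
    Otherwise [dball m] is "big"; bigness survives both the constraint [f a >= e] and, by
    weak-* compactness of [dball m], the constraint [f a <= e / 2] for [U]-almost all [a].
    This yields a bounded sequence that is independent on [dball m], hence a copy of l1.
    Applied to the complements of finite unions of members of a sigma-locally finite
    k-network, this selection principle shows that [0] has a countable weak neighbourhood
    base in [B]. So, for the uniform norm on [B], each functional is approximated by linear
    combinations of countably many fixed ones, and the density condition turns this into
    separability of the strong dual.

    (c) => (b). Under the density condition a separable strong dual has a countable network
    [W n], in the sense that every [f] lies in some [W n] on which a given bounded set
    varies by at most [eps]. Weakly compact sets are bounded, so the sets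
    "[g y] is close to [q] for all [g] in [W n]", with finite intersections, form a
    countable weak k-network. *)

(** * Zorn's lemma, ultrafilters and ultralimits *)

Lemma zorn (T : Type) (R : T -> T -> Prop) :
  (forall t, R t t) -> (forall r s t, R r s -> R s t -> R r t) ->
  (forall s t, R s t -> R t s -> s = t) ->
  (forall A : T -> Prop, (forall s t, A s -> A t -> R s t \/ R t s) ->
     exists t, forall s, A s -> R s t) ->
  exists t, forall s, R t s -> s = t.
Proof.
  intros Rr Rt Ra Rc.
  (* The library version of Zorn's lemma takes a boolean relation, so [R] is decided by excluded
     middle. *)
  set (b := fun s t => if excluded_middle_informative (R s t) then true else false).
  assert (bE : forall s t, is_true (b s t) <-> R s t).
  { intros s t. unfold b, is_true.
    destruct (excluded_middle_informative (R s t)); split; intros; auto; discriminate. }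
  destruct (@classical_sets.Zorn T b) as [t Ht].
  - intros t. now apply bE.
  - intros r s t H1 H2. apply bE. apply Rt with s; now apply bE.
  - intros s t H1 H2. apply Ra; now apply bE.
  - intros A HA. destruct (Rc A) as [t Ht].
    + intros s t As At. destruct (HA s t As At) as [H|H]; apply bE in H; auto.
    + exists t. intros s As. apply bE; auto.
  - exists t. intros s Hs. apply Ht. now apply bE.
Qed.

Definition meets_finitely {X : Type} (F : (X -> Prop) -> Prop) : Prop :=
  forall L, (forall S, In S L -> F S) -> exists x, forall S, In S L -> S x.

Record ultrafilter {X : Type} (U : (X -> Prop) -> Prop) : Prop := {
  uf_up : forall P Q : X -> Prop, U P -> (forall x, P x -> Q x) -> U Q;
  uf_and : forall P Q : X -> Prop, U P -> U Q -> U (fun x => P x /\ Q x);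
  uf_ex : forall P : X -> Prop, U P -> exists x, P x;
  uf_em : forall P : X -> Prop, U P \/ U (fun x => ~ P x)
}.

Lemma ultrafilter_true {X : Type} (U : (X -> Prop) -> Prop) (P : X -> Prop) :
  ultrafilter U -> (forall x, P x) -> U P.
Proof.
  intros HU HP. destruct (uf_em U HU P) as [H|H]; auto.
  destruct (uf_ex U HU _ H) as [x Hx]. now destruct (Hx (HP x)).
Qed.

Lemma ultrafilter_bounded_and {X : Type} (U : (X -> Prop) -> Prop)
    (P : nat -> X -> Prop) n :
  ultrafilter U -> (forall i, (i < n)%nat -> U (P i)) ->
  U (fun x => forall i, (i < n)%nat -> P i x).
Proof.
  intros HU. induction n as [|n IH]; intros H.
  - apply ultrafilter_true; auto. intros x i Hi. lia.
  - apply (uf_up U HU (fun x => (forall i, (i < n)%nat -> P i x) /\ P n x)).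
    + apply (uf_and U HU); auto.
    + intros x [H1 H2] i Hi. destruct (Nat.eq_dec i n) as [->|Hn]; auto.
      apply H1. lia.
Qed.

Lemma ultrafilter_list_and {X I : Type} (U : (X -> Prop) -> Prop)
    (P : I -> X -> Prop) (L : list I) :
  ultrafilter U -> (forall i, In i L -> U (P i)) ->
  U (fun x => forall i, In i L -> P i x).
Proof.
  intros HU. induction L as [|j L IH]; intros H.
  - apply ultrafilter_true; auto. intros x i [].
  - apply (uf_up U HU (fun x => P j x /\ forall i, In i L -> P i x)).
    + apply (uf_and U HU); [apply H; now left|].
      apply IH. intros i Hi. apply H. now right.
    + intros x [H1 H2] i [->|Hi]; auto.
Qed.

(** Zorn's lemma is applied to the families that contain [F] and have the finite intersection
    property. The union of a chain qualifies because any finite part of it already lies in one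
    member of the chain. *)
Lemma ultrafilter_exists {X : Type} (F : (X -> Prop) -> Prop) :
  meets_finitely F -> exists U, ultrafilter U /\ forall S, F S -> U S.
Proof.
  intros HF.
  set (T := {G : (X -> Prop) -> Prop | meets_finitely G /\ forall S, F S -> G S}).
  set (R := fun G H : T => forall S, proj1_sig G S -> proj1_sig H S).
  destruct (zorn T R) as [[G [Gm GF]] Gmax].
  - intros G S; auto.
  - intros G H K GH HK S HS. auto.
  - intros [G HG] [H HH] GH HGr. apply subset_eq_compat.
    apply functional_extensionality. intros S. apply propositional_extensionality.
    split; [apply GH|apply HGr].
  - intros A HA.
    (* Adjoining [F] gives an upper bound to the empty chain as well. *)
    set (G := fun S => F S \/ exists H : T, A H /\ proj1_sig H S).
    assert (Gm : meets_finitely G).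
    { intros L HL.
      assert (K : (forall S, In S L -> F S) \/
                  exists H : T, A H /\ forall S, In S L -> proj1_sig H S).
      { clear -HA HL. induction L as [|S L IH].
        - left. intros S [].
        - assert (HS : G S) by (apply HL; now left).
          destruct IH as [IH|[H [AH IH]]]; [intros S' H'; apply HL; now right| |].
          + destruct HS as [HS|[H [AH HS]]].
            * left. intros S' [<-|H']; auto.
            * right. exists H. split; auto. intros S' [<-|H']; auto.
              apply (proj2 (proj2_sig H)). auto.
          + right. destruct HS as [HS|[H' [AH' HS]]].
            * exists H. split; auto. intros S' [<-|HS']; auto.
              apply (proj2 (proj2_sig H)). auto.
            * destruct (HA H H' AH AH') as [C|C].
              -- exists H'. split; auto. intros S' [<-|HS']; auto.
              -- exists H. split; auto. intros S' [<-|HS']; auto. }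
      destruct K as [K|[H [AH K]]]; [now apply HF|].
      now apply (proj1 (proj2_sig H)). }
    exists (exist _ G (conj Gm (fun S HS => or_introl HS))).
    intros H AH S HS. right. now exists H.
  (* Maximality: [G] contains every set that meets all finite intersections of members of [G]. The
     four ultrafilter axioms are then read off. *)
  - assert (ext : forall P : X -> Prop,
      (forall L, (forall S, In S L -> G S) -> exists x, P x /\ forall S, In S L -> S x) ->
      G P).
    { intros P HP.
      set (H := fun S => G S \/ S = P).
      assert (Hm : meets_finitely H).
      { intros L HL.
        assert (K : exists L', (forall S, In S L' -> G S) /\
                               forall S, In S L -> In S L' \/ S = P).
        { clear -HL. induction L as [|S L IH].
          - exists nil. split; intros S [].
          - destruct IH as [L' [H1 H2]]; [intros S' HS'; apply HL; now right|].
            destruct (HL S) as [HS|HS]; [now left| |].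
            + exists (S :: L'). split.
              * intros S' [<-|HS']; auto.
              * intros S' [<-|HS']; [left; now left|].
                destruct (H2 S' HS'); auto. left; now right.
            + exists L'. split; auto. intros S' [<-|HS']; auto. }
        destruct K as [L' [H1 H2]]. destruct (HP L' H1) as [x [Px Hx]].
        exists x. intros S HS. destruct (H2 S HS) as [K| ->]; [apply Hx|]; auto. }
      assert (E := Gmax (exist _ H (conj Hm (fun S HS => or_introl (GF S HS))))
                        (fun S HS => or_introl HS)).
      apply (f_equal (@proj1_sig _ _)) in E. simpl in E. rewrite <- E. now right. }
    exists G. split; auto. split.
    + intros P Q HP PQ. apply ext. intros L HL.
      destruct (Gm (P :: L)) as [x Hx]; [intros S [<-|HS]; auto|].
      exists x. split; [apply PQ; apply Hx; now left|intros S HS; apply Hx; now right].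
    + intros P Q HP HQ. apply ext. intros L HL.
      destruct (Gm (P :: Q :: L)) as [x Hx]; [intros S [<-|[<-|HS]]; auto|].
      exists x. repeat split.
      * apply Hx; now left.
      * apply Hx; right; now left.
      * intros S HS; apply Hx; right; now right.
    + intros P HP. destruct (Gm (P :: nil)) as [x Hx]; [intros S [<-|[]]; auto|].
      exists x. apply Hx; now left.
    (* If the complement of [P] misses the intersection of some finite [L], then that intersection
       lies inside [P], which forces [P] into [G]. *)
    + intros P. destruct (classic (G P)) as [HP|HP]; auto. right.
      apply ext. intros L HL. apply NNPP. intros N. apply HP. apply ext. intros L' HL'.
      destruct (Gm (L ++ L')) as [x Hx].
      { intros S HS. apply in_app_or in HS. destruct HS; auto. }
      exists x. split.
      * apply NNPP. intros NP. apply N. exists x. split; auto.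
        intros S HS. apply Hx. apply in_or_app. now left.
      * intros S HS. apply Hx. apply in_or_app. now right.
Qed.

(** The limit is the supremum of the [t] for which [t <= g x] holds for [U]-almost all [x]; the
    bound [M] makes this supremum finite. *)
Lemma ultralimit_exists {X : Type} (U : (X -> Prop) -> Prop) (g : X -> R) M :
  ultrafilter U -> (forall x, Rabs (g x) <= M) ->
  exists r, forall e, 0 < e -> U (fun x => Rabs (g x - r) < e).
Proof.
  intros HU HM.
  destruct (completeness (fun t => U (fun x => t <= g x))) as [r [Hub Hlub]].
  - exists M. intros t Ht. destruct (uf_ex U HU _ Ht) as [x Hx].
    specialize (HM x). pose proof (Rle_abs (g x)). lra.
  - exists (-M). apply ultrafilter_true; auto. intros x.
    specialize (HM x). pose proof (Rle_abs (- g x)). rewrite Rabs_Ropp in *. lra.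
  - exists r. intros e He.
    assert (H1 : U (fun x => g x < r + e)).
    { destruct (uf_em U HU (fun x => r + e <= g x)) as [H|H].
      - specialize (Hub _ H). lra.
      - apply (uf_up U HU _ _ H). intros x Hx. lra. }
    assert (H2 : U (fun x => r - e < g x)).
    { apply NNPP. intros N.
      assert (r <= r - e); [|lra]. apply Hlub. intros t Ht.
      apply Rnot_lt_le. intros Hlt. apply N.
      apply (uf_up U HU _ _ Ht). intros x Hx. lra. }
    apply (uf_up U HU _ _ (uf_and U HU _ _ H1 H2)).
    intros x [Ha Hb]. apply Rabs_def1; lra.
Qed.

(** * Choice, coding of finite lists and a dense sequence of reals *)

Lemma choice_fun {A B : Type} (R : A -> B -> Prop) :
  (forall a, exists b, R a b) -> exists f : A -> B, forall a, R a (f a).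
Proof.
  intros H. exists (fun a => proj1_sig (constructive_indefinite_description _ (H a))).
  intros a. apply proj2_sig.
Qed.

Fixpoint list_code (l : list nat) : nat :=
  match l with
  | nil => O
  | a :: l' => S (Cantor.to_nat (a, list_code l'))
  end.

Lemma list_code_inj l l' : list_code l = list_code l' -> l = l'.
Proof.
  revert l'. induction l as [|a l IH]; intros [|b l'] H; cbn [list_code] in H;
    try discriminate; auto.
  apply eq_add_S in H.
  apply (f_equal Cantor.of_nat) in H. rewrite !Cantor.cancel_of_to in H.
  injection H as -> H. f_equal. auto.
Qed.

Lemma nat_lists_countable : exists dec : nat -> list nat, forall l, exists n, dec n = l.
Proof.
  destruct (choice_fun (fun n l => (exists l', list_code l' = n) -> list_code l = n))
    as [dec Hdec].
  - intros n. destruct (classic (exists l', list_code l' = n)) as [[l Hl]|H].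
    + now exists l.
    + exists nil. tauto.
  - exists dec. intros l. exists (list_code l). apply list_code_inj.
    apply Hdec. now exists l.
Qed.

Lemma dense_sequence : exists q : nat -> R, forall r e, 0 < e -> exists n, Rabs (q n - r) < e.
Proof.
  exists (fun n => let (a, m) := Cantor.of_nat n in let (b, c) := Cantor.of_nat m in
           (INR a - INR b) / INR (S c)).
  intros r e He.
  destruct (archimed_cor1 e He) as [c [Hc Hc0]]. destruct c as [|c]; [lia|].
  (* Rounding [r * (c + 1)] up costs at most 1, hence at most [/ INR (S c) < e] after division. The
     integer [z] is split into a difference of naturals to match the enumeration. *)
  set (z := up (r * INR (S c))).
  assert (Hz : exists a b, INR a - INR b = IZR z).
  { exists (Z.to_nat z), (Z.to_nat (- z)). rewrite !INR_IZR_INZ, <- minus_IZR.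
    f_equal. lia. }
  destruct Hz as [a [b Hz]].
  exists (Cantor.to_nat (a, Cantor.to_nat (b, c))).
  rewrite !Cantor.cancel_of_to, Hz.
  assert (Hp : 0 < INR (S c)) by (apply lt_0_INR; lia).
  destruct (archimed (r * INR (S c))) as [A1 A2]. fold z in A1, A2.
  replace (IZR z / INR (S c) - r) with ((IZR z - r * INR (S c)) * / INR (S c))
    by (field; lra).
  rewrite Rabs_pos_eq.
  - apply Rle_lt_trans with (2 := Hc). rewrite <- (Rmult_1_l (/ INR (S c))) at 2.
    apply Rmult_le_compat_r; [|lra]. left. now apply Rinv_0_lt_compat.
  - apply Rmult_le_pos; [lra|]. left. now apply Rinv_0_lt_compat.
Qed.

(** * Seminorms and functionals on a Frechet space *)

Local Notation "x [+] y" := (vadd _ x y) (at level 50, left associativity).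
Local Notation "c [*] x" := (vscal _ c x) (at level 40, left associativity).

Lemma vadd_0l (E : Frechet) (x : E) : v0 E [+] x = x.
Proof. now rewrite vaddC, vadd0. Qed.

Lemma vadd_cancel_r (E : Frechet) (x y z : E) : x [+] z = y [+] z -> x = y.
Proof.
  intros H. apply (f_equal (fun w => w [+] vopp E z)) in H.
  now rewrite <- !vaddA, !vaddN, !vadd0 in H.
Qed.

Lemma vscal_0l (E : Frechet) (x : E) : 0 [*] x = v0 E.
Proof.
  apply vadd_cancel_r with (0 [*] x). rewrite vadd_0l, <- vscalDl. f_equal. lra.
Qed.

Lemma vscal_0r (E : Frechet) c : c [*] v0 E = v0 E.
Proof. now rewrite <- (vscal_0l E (v0 E)), vscalA, Rmult_0_r. Qed.

Lemma vopp_scal (E : Frechet) (x : E) : vopp E x = (-1) [*] x.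
Proof.
  apply vadd_cancel_r with x. rewrite vaddC, vaddN.
  rewrite <- (vscal1 E x) at 2. rewrite <- vscalDl.
  replace (-1 + 1) with 0 by lra. now rewrite vscal_0l.
Qed.

Lemma vadd_swap (E : Frechet) (a b c d : E) :
  (a [+] b) [+] (c [+] d) = (a [+] c) [+] (b [+] d).
Proof.
  rewrite <- !vaddA. f_equal. rewrite !vaddA. f_equal. apply vaddC.
Qed.

Lemma vsub_add (E : Frechet) (a b c d : E) :
  vsub E (a [+] b) (c [+] d) = vsub E a c [+] vsub E b d.
Proof. unfold vsub. rewrite !vopp_scal, vscalDr. apply vadd_swap. Qed.

Lemma vsub_scal (E : Frechet) c (a b : E) :
  vsub E (c [*] a) (c [*] b) = c [*] vsub E a b.
Proof.
  unfold vsub. rewrite !vopp_scal, vscalDr, !vscalA. do 2 f_equal. ring.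
Qed.

Lemma vsub_self (E : Frechet) (a : E) : vsub E a a = v0 E.
Proof. apply vaddN. Qed.

Lemma vsub_0r (E : Frechet) (a : E) : vsub E a (v0 E) = a.
Proof. unfold vsub. now rewrite vopp_scal, vscal_0r, vadd0. Qed.

Lemma vsub_opp (E : Frechet) (a b : E) : vsub E a b = (-1) [*] vsub E b a.
Proof.
  unfold vsub. rewrite !vopp_scal, vscalDr, !vscalA, vaddC.
  replace (-1 * -1) with 1 by ring. now rewrite vscal1.
Qed.

Lemma vsub_addK (E : Frechet) (a b : E) : vsub E a b [+] b = a.
Proof. unfold vsub. now rewrite <- vaddA, (vaddC E _ b), vaddN, vadd0. Qed.

Lemma vsub_trans (E : Frechet) (a b c : E) : vsub E a c = vsub E a b [+] vsub E b c.
Proof. apply vadd_cancel_r with c. now rewrite <- vaddA, !vsub_addK. Qed.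

Lemma vsub_eq0 (E : Frechet) (a b : E) : vsub E a b = v0 E -> a = b.
Proof. intros H. now rewrite <- (vsub_addK E a b), H, vadd_0l. Qed.

Lemma sem_0 (E : Frechet) n : sem E n (v0 E) = 0.
Proof. rewrite <- (vscal_0l E (v0 E)), sem_homog, Rabs_R0. ring. Qed.

Lemma sem_opp (E : Frechet) n (x : E) : sem E n ((-1) [*] x) = sem E n x.
Proof. rewrite sem_homog. replace (-1) with (-(1)) by lra. rewrite Rabs_Ropp, Rabs_R1. ring. Qed.

Lemma sem_sub_sym (E : Frechet) n (x y : E) : sem E n (vsub E x y) = sem E n (vsub E y x).
Proof. rewrite (vsub_opp E x y). apply sem_opp. Qed.

Lemma sem_ge0 (E : Frechet) n (x : E) : 0 <= sem E n x.
Proof.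
  pose proof (sem_triangle E n x ((-1) [*] x)) as H.
  rewrite <- vopp_scal, vaddN, sem_0, vopp_scal, sem_opp in H. lra.
Qed.

Lemma sem_le_maxsem (E : Frechet) n i (x : E) : (i <= n)%nat -> sem E i x <= maxsem E n x.
Proof.
  induction n as [|n IH]; intros H; simpl.
  - replace i with O by lia. lra.
  - destruct (Nat.eq_dec i (S n)) as [->|Hn]; [apply Rmax_r|].
    apply Rle_trans with (2 := Rmax_l _ _). apply IH. lia.
Qed.

Lemma maxsem_le (E : Frechet) n (x : E) M :
  (forall i, (i <= n)%nat -> sem E i x <= M) -> maxsem E n x <= M.
Proof.
  induction n as [|n IH]; intros H; simpl; [now apply H|].
  apply Rmax_lub; [|now apply H]. apply IH. intros i Hi. apply H. lia.
Qed.

Lemma maxsem_mono (E : Frechet) n m (x : E) : (n <= m)%nat -> maxsem E n x <= maxsem E m x.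
Proof. intros H. apply maxsem_le. intros i Hi. apply sem_le_maxsem. lia. Qed.

Lemma maxsem_ge0 (E : Frechet) n (x : E) : 0 <= maxsem E n x.
Proof.
  apply Rle_trans with (sem E n x); [apply sem_ge0|now apply sem_le_maxsem].
Qed.

Lemma maxsem_triangle (E : Frechet) n (x y : E) :
  maxsem E n (x [+] y) <= maxsem E n x + maxsem E n y.
Proof.
  apply maxsem_le. intros i Hi. apply Rle_trans with (1 := sem_triangle E i x y).
  apply Rplus_le_compat; now apply sem_le_maxsem.
Qed.

Lemma maxsem_homog (E : Frechet) n c (x : E) :
  maxsem E n (c [*] x) = Rabs c * maxsem E n x.
Proof.
  induction n as [|n IH]; simpl; [apply sem_homog|].
  rewrite IH, sem_homog. apply RmaxRmult. apply Rabs_pos.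
Qed.

Lemma ev_add (E : Frechet) (f : dual E) x y : ev E f (x [+] y) = ev E f x + ev E f y.
Proof. apply (proj1 (proj1 (proj2_sig f))). Qed.

Lemma ev_scal (E : Frechet) (f : dual E) c x : ev E f (c [*] x) = c * ev E f x.
Proof. apply (proj2 (proj1 (proj2_sig f))). Qed.

Lemma ev_0 (E : Frechet) (f : dual E) : ev E f (v0 E) = 0.
Proof. rewrite <- (vscal_0l E (v0 E)), ev_scal. ring. Qed.

Lemma ev_sub (E : Frechet) (f : dual E) x y : ev E f (vsub E x y) = ev E f x - ev E f y.
Proof. unfold vsub. rewrite ev_add, vopp_scal, ev_scal. ring. Qed.

(** * Equicontinuous balls of the dual and the density condition *)

Definition dball (E : Frechet) (m : nat) (f : dual E) : Prop :=
  forall x, Rabs (ev E f x) <= INR m * maxsem E m x.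

Lemma dball_mono (E : Frechet) m n f : (m <= n)%nat -> dball E m f -> dball E n f.
Proof.
  intros H Hf x. apply Rle_trans with (1 := Hf x).
  apply Rmult_le_compat; [apply pos_INR|apply maxsem_ge0|now apply le_INR|now apply maxsem_mono].
Qed.

Lemma INR_above (M : R) : exists n, M < INR n.
Proof.
  destruct (INR_unbounded M) as [n Hn]. exists n. lra.
Qed.

Lemma dball_ex (E : Frechet) (f : dual E) : exists m, dball E m f.
Proof.
  destruct f as [f [Hl [n [C HC]]]].
  destruct (INR_above C) as [k Hk].
  exists (n + k)%nat. intros x. apply Rle_trans with (1 := HC x).
  apply Rle_trans with (INR (n + k) * maxsem E n x).
  - apply Rmult_le_compat_r; [apply maxsem_ge0|].
    rewrite plus_INR. pose proof (pos_INR n). lra.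
  - apply Rmult_le_compat_l; [apply pos_INR|]. apply maxsem_mono. lia.
Qed.

Lemma daxpy_dual (E : Frechet) (c : R) (g h : dual E) :
  is_linear E (fun x => ev E h x + c * ev E g x) /\
  exists n C, forall x, Rabs (ev E h x + c * ev E g x) <= C * maxsem E n x.
Proof.
  split.
  - split; intros.
    + rewrite !ev_add. ring.
    + rewrite !ev_scal. ring.
  - destruct (dball_ex E g) as [m Hm]. destruct (dball_ex E h) as [n Hn].
    set (k := Nat.max m n).
    apply (dball_mono E m k) in Hm; [|lia]. apply (dball_mono E n k) in Hn; [|lia].
    exists k, (INR k + Rabs c * INR k). intros x.
    apply Rle_trans with (1 := Rabs_triang _ _). rewrite Rabs_mult, Rmult_plus_distr_r.
    apply Rplus_le_compat; auto. rewrite Rmult_assoc.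
    apply Rmult_le_compat_l; auto. apply Rabs_pos.
Qed.

(** This single operation provides all the linear structure needed on the dual: [daxpy E (-1) g f]
    is [f - g], and [daxpy E (-2) f f] is [- f]. *)
Definition daxpy (E : Frechet) (c : R) (g h : dual E) : dual E :=
  exist _ (fun x => ev E h x + c * ev E g x) (daxpy_dual E c g h).

Lemma dzero_dual (E : Frechet) :
  is_linear E (fun _ => 0) /\ exists n C, forall x : E, Rabs 0 <= C * maxsem E n x.
Proof.
  split.
  - split; intros; ring.
  - exists O, 0. intros x. rewrite Rabs_R0. lra.
Qed.

Definition dzero (E : Frechet) : dual E := exist _ (fun _ => 0) (dzero_dual E).

Lemma maxsem_bounded_on (E : Frechet) (B : E -> Prop) m :
  E_bounded E B -> exists M, 0 <= M /\ forall x, B x -> maxsem E m x <= M.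
Proof.
  intros HB. induction m as [|m [M [HM0 HM]]].
  - destruct (HB O) as [M HM]. exists (Rmax 0 M). split; [apply Rmax_l|].
    intros x Bx. simpl. apply Rle_trans with (2 := Rmax_r _ _). auto.
  - destruct (HB (S m)) as [M' HM']. exists (Rmax M M'). split.
    + apply Rle_trans with (1 := HM0). apply Rmax_l.
    + intros x Bx. apply Rmax_lub.
      * apply Rle_trans with (2 := Rmax_l _ _). auto.
      * apply Rle_trans with (2 := Rmax_r _ _). auto.
Qed.

Lemma dball_strong_bounded (E : Frechet) m : strong_bounded E (dball E m).
Proof.
  intros B HB. destruct (maxsem_bounded_on E B m HB) as [M [HM0 HM]].
  exists (INR m * M). intros f x Hf Bx.
  apply Rle_trans with (1 := Hf x). apply Rmult_le_compat_l; [apply pos_INR|auto].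
Qed.

Lemma dual_bounded_on (E : Frechet) (B : E -> Prop) (f : dual E) :
  E_bounded E B -> exists M, forall x, B x -> Rabs (ev E f x) <= M.
Proof.
  intros HB. destruct (dball_ex E f) as [m Hm].
  destruct (dball_strong_bounded E m B HB) as [M HM]. exists M. auto.
Qed.

(** The list is finite, so the margin [d] expresses strict inequality for all its members at once
    and leaves room to move [y]. For [0 < r] these sets serve as basic neighbourhoods of [x]. *)
Lemma weak_open_open_slab (E : Frechet) (L : list (dual E)) (x : E) r :
  weak_open E (fun y => exists d, 0 < d /\
    forall f, In f L -> Rabs (ev E f (vsub E y x)) <= r - d).
Proof.
  intros y [d [Hd Hy]]. exists L, (d / 2). split; [lra|]. intros z Hz.
  exists (d / 2). split; [lra|]. intros f Hf.
  specialize (Hy f Hf). specialize (Hz f Hf).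
  rewrite ev_sub in *.
  replace (ev E f z - ev E f x) with ((ev E f z - ev E f y) + (ev E f y - ev E f x)) by ring.
  pose proof (Rabs_triang (ev E f z - ev E f y) (ev E f y - ev E f x)). lra.
Qed.

Lemma weak_open_ev_lt (E : Frechet) (f : dual E) r :
  weak_open E (fun y => Rabs (ev E f y) < r).
Proof.
  intros y Hy. exists (f :: nil), (r - Rabs (ev E f y)). split; [lra|].
  intros z Hz. specialize (Hz f (or_introl eq_refl)). rewrite ev_sub in Hz.
  replace (ev E f z) with ((ev E f z - ev E f y) + ev E f y) by ring.
  pose proof (Rabs_triang (ev E f z - ev E f y) (ev E f y)). lra.
Qed.

(** The margin [d] is uniform over [B]: the set is an open ball for the supremum over [B], whereas a
    pointwise strict inequality on an infinite [B] need not define an open set. *)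
Lemma strong_open_sup_lt (E : Frechet) (B : E -> Prop) (f : dual E) e :
  E_bounded E B ->
  strong_open E (fun g => exists d, d < e /\ forall x, B x -> Rabs (ev E g x - ev E f x) <= d).
Proof.
  intros HB g [d [Hd Hg]]. exists B, ((e - d) / 2). split; auto. split; [lra|].
  intros h Hh. exists ((e + d) / 2). split; [lra|]. intros x Bx.
  specialize (Hg x Bx). specialize (Hh x Bx).
  replace (ev E h x - ev E f x) with ((ev E h x - ev E g x) + (ev E g x - ev E f x)) by ring.
  pose proof (Rabs_triang (ev E h x - ev E g x) (ev E g x - ev E f x)). lra.
Qed.

(** Differences of members of [dball E m] lie in [dball E (m + m)], which is metrizable. A countable
    base at zero of this larger ball therefore controls all pairs [f], [g] uniformly. *)
Lemma density_condition_dball_countable (E : Frechet) (m : nat) :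
  density_condition E ->
  exists (B : nat -> E -> Prop) (e : nat -> R),
    (forall k, E_bounded E (B k) /\ 0 < e k) /\
    forall C eps, E_bounded E C -> 0 < eps -> exists k, forall f g,
      dball E m f -> dball E m g ->
      (forall x, B k x -> Rabs (ev E f x - ev E g x) <= e k) ->
      forall x, C x -> Rabs (ev E f x - ev E g x) <= eps.
Proof.
  intros DC.
  set (A := dball E (m + m)).
  destruct (DC A (dball_strong_bounded E _)) as [d [dpos [d0 [dsym [dtri dtop]]]]].
  assert (A0 : A (dzero E)).
  { intros x. simpl. rewrite Rabs_R0.
    apply Rmult_le_pos; [apply pos_INR|apply maxsem_ge0]. }
  assert (Asub : forall f g, dball E m f -> dball E m g -> A (daxpy E (-1) g f)).
  { intros f g Hf Hg x. simpl.
    replace (ev E f x + -1 * ev E g x) with (ev E f x + - ev E g x) by ring.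
    apply Rle_trans with (1 := Rabs_triang _ _). rewrite Rabs_Ropp.
    specialize (Hf x). specialize (Hg x).
    apply Rle_trans with ((INR m + INR m) * maxsem E m x); [lra|].
    rewrite <- plus_INR. apply Rmult_le_compat_l; [apply pos_INR|].
    apply maxsem_mono. lia. }
  (* The metric ball of radius [/ INR (S k)] around zero is relatively open, so it contains the
     trace of a basic strong neighbourhood. *)
  assert (K : forall k : nat, exists Be : (E -> Prop) * R, E_bounded E (fst Be) /\ 0 < snd Be /\
     forall g, A g -> (forall x, fst Be x -> Rabs (ev E g x) <= snd Be) ->
       d (dzero E) g < / INR (S k)).
  { intros k.
    assert (Hk : 0 < / INR (S k)) by (apply Rinv_0_lt_compat, lt_0_INR; lia).
    destruct (proj2 (dtop (fun g => A g /\ d (dzero E) g < / INR (S k))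
                          (fun g H => proj1 H))) as [U [HU HUA]].
    { intros g [Ag Hg]. exists (/ INR (S k) - d (dzero E) g). split; [lra|].
      intros h Ah Hh. split; auto. pose proof (dtri _ _ _ A0 Ag Ah). lra. }
    destruct (HU (dzero E)) as [B [e [HB [He HBe]]]].
    { apply HUA; auto. split; auto.
      rewrite (proj2 (d0 _ _ A0 A0) eq_refl). auto. }
    exists (B, e). split; auto. split; auto. intros g Ag Hg. simpl in Hg.
    apply HUA; auto. apply HBe. intros x Bx. simpl. rewrite Rminus_0_r. auto. }
  destruct (choice_fun _ K) as [Be HBe].
  exists (fun k => fst (Be k)), (fun k => snd (Be k)). split.
  { intros k. destruct (HBe k) as [H1 [H2 _]]. auto. }
  intros C eps HC Heps.
  set (U := fun g => exists dl, dl < eps /\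
              forall x, C x -> Rabs (ev E g x - ev E (dzero E) x) <= dl).
  (* Conversely the trace of the strong neighbourhood given by [C] and [eps] contains a metric ball,
     of some radius [r]. *)
  destruct (proj1 (dtop (fun g => A g /\ U g) (fun g H => proj1 H))) with (dzero E)
    as [r [Hr Hball]].
  { exists U. split; [now apply strong_open_sup_lt|]. intros g Ag. tauto. }
  { split; auto. exists 0. split; auto. intros x _. simpl. rewrite Rminus_0_r, Rabs_R0. lra. }
  destruct (archimed_cor1 r Hr) as [k [Hk Hk0]]. destruct k as [|k]; [lia|].
  exists k. intros f g Hf Hg Hfg x Cx.
  destruct (Hball (daxpy E (-1) g f)) as [_ [dl [Hdl H]]]; auto.
  { apply Rlt_trans with (2 := Hk). apply HBe; auto.
    intros y By. simpl. replace (ev E f y + -1 * ev E g y) with (ev E f y - ev E g y) by ring.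
    now apply Hfg. }
  specialize (H x Cx). simpl in H.
  replace (ev E f x + -1 * ev E g x - 0) with (ev E f x - ev E g x) in H by ring. lra.
Qed.

Lemma density_condition_countable (E : Frechet) :
  density_condition E ->
  exists (B : nat -> nat -> E -> Prop) (e : nat -> nat -> R),
    (forall m k, E_bounded E (B m k) /\ 0 < e m k) /\
    forall m C eps, E_bounded E C -> 0 < eps -> exists k, forall f g,
      dball E m f -> dball E m g ->
      (forall x, B m k x -> Rabs (ev E f x - ev E g x) <= e m k) ->
      forall x, C x -> Rabs (ev E f x - ev E g x) <= eps.
Proof.
  intros DC.
  destruct (choice_fun _ (fun m => density_condition_dball_countable E m DC)) as [B HB].
  destruct (choice_fun _ HB) as [e He].
  exists B, e. split.
  - intros m. apply He.
  - intros m. apply He.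
Qed.

(** * Sequences equivalent to the unit vector basis of l1 *)

Definition vconv (E : Frechet) (u : nat -> E) (l : E) : Prop :=
  forall n eps, 0 < eps -> exists N, forall i, (N <= i)%nat -> sem E n (vsub E (u i) l) < eps.

Lemma sem_sub_triangle (E : Frechet) n (x y z : E) :
  sem E n (vsub E x z) <= sem E n (vsub E x y) + sem E n (vsub E y z).
Proof. rewrite (vsub_trans E x y z). apply sem_triangle. Qed.

Lemma vconv_unique (E : Frechet) u (l l' : E) : vconv E u l -> vconv E u l' -> l = l'.
Proof.
  intros H H'. apply vsub_eq0, sem_separating. intros n.
  apply Rle_antisym; [|apply sem_ge0]. apply Rle_plus_epsilon. intros eps He.
  destruct (H n (eps / 2)) as [N HN]; [lra|]. destruct (H' n (eps / 2)) as [N' HN']; [lra|].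
  specialize (HN (N + N')%nat ltac:(lia)). specialize (HN' (N + N')%nat ltac:(lia)).
  pose proof (sem_sub_triangle E n l (u (N + N')%nat) l').
  rewrite (sem_sub_sym E n l (u _)) in H0. lra.
Qed.

Lemma vconv_add (E : Frechet) u v (l k : E) :
  vconv E u l -> vconv E v k -> vconv E (fun i => u i [+] v i) (l [+] k).
Proof.
  intros Hu Hv n eps He.
  destruct (Hu n (eps / 2)) as [N HN]; [lra|]. destruct (Hv n (eps / 2)) as [N' HN']; [lra|].
  exists (N + N')%nat. intros i Hi. rewrite vsub_add.
  apply Rle_lt_trans with (1 := sem_triangle _ _ _ _).
  specialize (HN i ltac:(lia)). specialize (HN' i ltac:(lia)). lra.
Qed.

Lemma vconv_scal (E : Frechet) u c (l : E) :
  vconv E u l -> vconv E (fun i => c [*] u i) (c [*] l).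
Proof.
  intros Hu n eps He. pose proof (Rabs_pos c).
  destruct (Hu n (eps / (Rabs c + 1))) as [N HN].
  { apply Rdiv_lt_0_compat; lra. }
  exists N. intros i Hi. rewrite vsub_scal, sem_homog.
  specialize (HN i Hi). pose proof (sem_ge0 E n (vsub E (u i) l)).
  apply Rle_lt_trans with ((Rabs c + 1) * sem E n (vsub E (u i) l)); [nra|].
  apply Rmult_lt_compat_l with (r := Rabs c + 1) in HN; [|lra].
  replace ((Rabs c + 1) * (eps / (Rabs c + 1))) with eps in HN by (field; lra). lra.
Qed.

Lemma vconv_maxsem (E : Frechet) u (l : E) m eps :
  vconv E u l -> 0 < eps ->
  exists N, forall i, (N <= i)%nat -> maxsem E m (vsub E (u i) l) < eps.
Proof.
  intros Hu He. induction m as [|m [N HN]]; [now apply Hu|].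
  destruct (Hu (S m) eps He) as [N' HN'].
  exists (N + N')%nat. intros i Hi. simpl. apply Rmax_lub_lt; [apply HN|apply HN']; lia.
Qed.

Fixpoint vsum (E : Frechet) (u : nat -> E) (n : nat) : E :=
  match n with
  | O => u O
  | S k => vsum E u k [+] u (S k)
  end.

Lemma vsum_add (E : Frechet) u v n :
  vsum E (fun k => u k [+] v k) n = vsum E u n [+] vsum E v n.
Proof. induction n as [|n IH]; simpl; auto. rewrite IH. apply vadd_swap. Qed.

Lemma vsum_scal (E : Frechet) c u n :
  vsum E (fun k => c [*] u k) n = c [*] vsum E u n.
Proof. induction n as [|n IH]; simpl; auto. now rewrite IH, vscalDr. Qed.

Lemma ev_vsum (E : Frechet) (f : dual E) u n :
  ev E f (vsum E u n) = sum_f_R0 (fun k => ev E f (u k)) n.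
Proof. induction n as [|n IH]; simpl; auto. now rewrite ev_add, IH. Qed.

Lemma sem_vsum_le (E : Frechet) (a : nat -> R) (b : nat -> E) n M N :
  (forall k, sem E n (b k) <= M) ->
  sem E n (vsum E (fun k => a k [*] b k) N) <= M * sum_f_R0 (fun k => Rabs (a k)) N.
Proof.
  intros HM.
  assert (K : forall k, sem E n (a k [*] b k) <= M * Rabs (a k)).
  { intros k. rewrite sem_homog, Rmult_comm. apply Rmult_le_compat_r; [apply Rabs_pos|auto]. }
  induction N as [|N IH]; simpl; [apply K|].
  apply Rle_trans with (1 := sem_triangle _ _ _ _). rewrite Rmult_plus_distr_l.
  apply Rplus_le_compat; auto.
Qed.

Lemma sem_vsum_sub_le (E : Frechet) (a : nat -> R) (b : nat -> E) n M j d :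
  (forall k, sem E n (b k) <= M) ->
  sem E n (vsub E (vsum E (fun k => a k [*] b k) (d + j)) (vsum E (fun k => a k [*] b k) j))
  <= M * (sum_f_R0 (fun k => Rabs (a k)) (d + j) - sum_f_R0 (fun k => Rabs (a k)) j).
Proof.
  intros HM. induction d as [|d IH]; simpl.
  - rewrite vsub_self, sem_0. apply Req_le. ring.
  - unfold vsub in *. rewrite <- vaddA, (vaddC E (_ [*] _)), vaddA.
    apply Rle_trans with (1 := sem_triangle _ _ _ _).
    rewrite sem_homog. pose proof (Rabs_pos (a (S (d + j)))). specialize (HM (S (d + j))).
    nra.
Qed.

(** The partial sums are Cauchy: if [M] bounds the seminorm [n] on the [b k], their differences are
    at most [M] times those of the partial sums of [|a k|]. *)
Lemma vsum_l1_conv (E : Frechet) (a : nat -> R) (b : nat -> E) :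
  E_bounded E (fun x => exists k, x = b k) -> summable a ->
  exists l, vconv E (vsum E (fun k => a k [*] b k)) l.
Proof.
  intros Hb [s Hs]. apply (complete E). intros n eps He.
  destruct (Hb n) as [M HM].
  assert (HM' : forall k, sem E n (b k) <= M + 1).
  { intros k. specialize (HM (b k) (ex_intro _ k eq_refl)). lra. }
  assert (M0 : 0 < M + 1).
  { specialize (HM (b O) (ex_intro _ O eq_refl)). pose proof (sem_ge0 E n (b O)). lra. }
  destruct (Hs (eps / (2 * (M + 1)))) as [N HN]; [apply Rdiv_lt_0_compat; lra|].
  assert (K : forall i j, (N <= j)%nat -> (j <= i)%nat ->
    sem E n (vsub E (vsum E (fun k => a k [*] b k) i) (vsum E (fun k => a k [*] b k) j)) < eps).
  { intros i j Hj Hi. replace i with ((i - j) + j)%nat by lia.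
    apply Rle_lt_trans with (1 := sem_vsum_sub_le E a b n (M + 1) j (i - j) HM').
    pose proof (HN j Hj) as H1. pose proof (HN (i - j + j)%nat ltac:(lia)) as H2.
    unfold Rdist in *. apply Rabs_def2 in H1. apply Rabs_def2 in H2.
    apply Rlt_le_trans with ((M + 1) * (2 * (eps / (2 * (M + 1))))).
    - apply Rmult_lt_compat_l; lra.
    - apply Req_le. field. lra. }
  exists N. intros i j Hi Hj. destruct (Nat.le_ge_cases j i) as [H|H].
  - now apply K.
  - fold (vsub E (vsum E (fun k => a k [*] b k) i) (vsum E (fun k => a k [*] b k) j)).
    rewrite sem_sub_sym. now apply K.
Qed.

Lemma infinite_sum_partial_le (a : nat -> R) s N :
  infinite_sum (fun k => Rabs (a k)) s -> sum_f_R0 (fun k => Rabs (a k)) N <= s.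
Proof.
  intros H. apply (sum_incr (fun k => Rabs (a k))); [exact H|intros; apply Rabs_pos].
Qed.

Lemma summable_add a b : summable a -> summable b -> summable (fun n => a n + b n).
Proof.
  intros [s Hs] [t Ht].
  destruct (Rseries_CV_comp (fun n => Rabs (a n + b n)) (fun n => Rabs (a n) + Rabs (b n)))
    as [l Hl].
  - intros n. split; [apply Rabs_pos|apply Rabs_triang].
  - exists (s + t). pose proof (CV_plus _ _ _ _ Hs Ht) as K.
    intros eps He. destruct (K eps He) as [N HN]. exists N. intros n Hn.
    rewrite sum_plus. now apply HN.
  - exists l. exact Hl.
Qed.

Lemma summable_scal r a : summable a -> summable (fun n => r * a n).
Proof.
  intros [s Hs]. exists (Rabs r * s).
  assert (K : Un_cv (fun n => Rabs r * sum_f_R0 (fun k => Rabs (a k)) n) (Rabs r * s)).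
  { apply (CV_mult (fun _ => Rabs r)); [|exact Hs].
    intros eps He. exists O. intros n _. unfold Rdist. rewrite Rminus_diag, Rabs_R0. auto. }
  intros eps He. destruct (K eps He) as [N HN]. exists N. intros n Hn.
  rewrite <- (sum_eq (fun k => Rabs (a k) * Rabs r)).
  - rewrite <- scal_sum. now apply HN.
  - intros i _. rewrite Rabs_mult. ring.
Qed.

(* Rosenthal's estimate: with [f] adapted to the positive part of [a] and [g] to its
   complement, every term of [(f - g) (sum a_k b_k)] is at least [(e / 2) |a_k|]. *)
Lemma contains_l1_of_independent (E : Frechet) (b : nat -> E) (m : nat) e :
  0 < e -> E_bounded E (fun x => exists k, x = b k) ->
  (forall n (M : nat -> bool), exists f, dball E m f /\ forall k, (k < n)%nat ->
     if M k then e <= ev E f (b k) else ev E f (b k) <= e / 2) ->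
  contains_l1 E.
Proof.
  intros He Hb Hind.
  (* The value [v0 E] off the summable sequences is a dummy, as [contains_l1] constrains [T] on
     summable sequences only. *)
  destruct (choice_fun (fun a x => summable a -> vconv E (vsum E (fun k => a k [*] b k)) x))
    as [T HT].
  { intros a. destruct (classic (summable a)) as [H|H].
    - destruct (vsum_l1_conv E a b Hb H) as [l Hl]. now exists l.
    - exists (v0 E). tauto. }
  (* On a partial sum [x], the functionals [f] and [g] below give [e / 2 * sum |a k| <= f x - g x <=
     2 * m * maxsem m x], which explains [4 * m / e]. The added 1 keeps [c] positive when
     [m = 0]. *)
  set (c := (4 * INR m + 1) / e).
  assert (Hm0 := pos_INR m).
  assert (Hc : 0 < c) by (apply Rdiv_lt_0_compat; lra).
  assert (low : forall a N, sum_f_R0 (fun k => Rabs (a k)) N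
                  <= c * maxsem E m (vsum E (fun k => a k [*] b k) N)).
  { intros a N.
    destruct (Hind (S N) (fun k => if Rlt_dec 0 (a k) then true else false)) as [f [Bf Hf]].
    destruct (Hind (S N) (fun k => if Rlt_dec 0 (a k) then false else true)) as [g [Bg Hg]].
    set (x := vsum E (fun k => a k [*] b k) N).
    assert (H1 : e / 2 * sum_f_R0 (fun k => Rabs (a k)) N <= ev E f x - ev E g x).
    { unfold x. rewrite !ev_vsum, <- minus_sum, scal_sum. apply sum_Rle.
      intros k Hk. rewrite !ev_scal.
      specialize (Hf k ltac:(lia)). specialize (Hg k ltac:(lia)).
      destruct (Rlt_dec 0 (a k)) as [Ha|Ha].
      - rewrite Rabs_pos_eq by lra. nra.
      - rewrite Rabs_left1 by lra. nra. }
    specialize (Bf x). specialize (Bg x).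
    pose proof (Rle_abs (ev E f x)). pose proof (Rle_abs (- ev E g x)).
    rewrite Rabs_Ropp in *. pose proof (maxsem_ge0 E m x).
    apply Rmult_le_reg_l with e; auto. unfold c.
    replace (e * ((4 * INR m + 1) / e * maxsem E m x))
      with ((4 * INR m + 1) * maxsem E m x) by (field; lra). lra. }
  exists T. split; [|split; [|split]].
  - intros a a' Sa Sa'. apply vconv_unique with (vsum E (fun k => (a k + a' k) [*] b k)).
    + apply HT. now apply summable_add.
    + pose proof (vconv_add E _ _ _ _ (HT a Sa) (HT a' Sa')) as K.
      intros n eps Heps. destruct (K n eps Heps) as [N HN]. exists N. intros i Hi.
      specialize (HN i Hi). rewrite <- vsum_add in HN.
      replace (fun k => (a k + a' k) [*] b k) with (fun k => (a k [*] b k) [+] (a' k [*] b k));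
        auto.
      apply functional_extensionality. intros k. now rewrite vscalDl.
  - intros r a Sa. apply vconv_unique with (vsum E (fun k => (r * a k) [*] b k)).
    + apply HT. now apply summable_scal.
    + pose proof (vconv_scal E _ r _ (HT a Sa)) as K.
      intros n eps Heps. destruct (K n eps Heps) as [N HN]. exists N. intros i Hi.
      specialize (HN i Hi). rewrite <- vsum_scal in HN.
      replace (fun k => (r * a k) [*] b k) with (fun k => r [*] (a k [*] b k)); auto.
      apply functional_extensionality. intros k. now rewrite vscalA.
  - intros n. destruct (Hb n) as [M HM].
    assert (HM' : forall k, sem E n (b k) <= M) by (intros k; apply HM; now exists k).
    assert (M0 : 0 <= M) by (pose proof (sem_ge0 E n (b O)); specialize (HM' O); lra).
    exists M. intros a l Hl. apply Rle_plus_epsilon. intros eps Heps.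
    destruct (HT a (ex_intro _ l Hl) n eps Heps) as [N HN]. specialize (HN N (le_n N)).
    rewrite sem_sub_sym in HN.
    rewrite <- (vsub_addK E (T a) (vsum E (fun k => a k [*] b k) N)).
    apply Rle_trans with (1 := sem_triangle _ _ _ _).
    pose proof (sem_vsum_le E a b n M N HM').
    pose proof (Rmult_le_compat_l M _ _ M0 (infinite_sum_partial_le a l N Hl)). lra.
  - exists m, c. split; auto. intros a l Hl. apply Rle_plus_epsilon. intros eps Heps.
    destruct (vconv_maxsem E _ _ m (eps / (2 * c)) (HT a (ex_intro _ l Hl))) as [N HN].
    { apply Rdiv_lt_0_compat; lra. }
    destruct (Hl (eps / 2)) as [N' HN']; [lra|].
    specialize (HN (N + N')%nat ltac:(lia)). specialize (HN' (N + N')%nat ltac:(lia)).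
    unfold Rdist in HN'. apply Rabs_def2 in HN'.
    specialize (low a (N + N')%nat).
    set (x := vsum E (fun k => a k [*] b k) (N + N')) in *.
    pose proof (maxsem_triangle E m (vsub E x (T a)) (T a)) as H1. rewrite vsub_addK in H1.
    apply Rmult_lt_compat_l with (r := c) in HN; auto.
    replace (c * (eps / (2 * c))) with (eps / 2) in HN by (field; lra).
    apply Rmult_le_compat_l with (r := c) in H1; [|lra]. lra.
Qed.

(** * Weak convergence of sequences chosen from bounded sets *)

Definition hist {X : Type} (b : nat -> X) (k : nat) : list X := map b (seq 0 k).

Lemma hist_S {X : Type} (b : nat -> X) k : hist b (S k) = hist b k ++ b k :: nil.
Proof. unfold hist. now rewrite seq_S, map_app. Qed.

Lemma hist_cons {X : Type} (b : nat -> X) k :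
  hist b (S k) = b O :: hist (fun i => b (S i)) k.
Proof. unfold hist. simpl. now rewrite <- seq_shift, map_map. Qed.

Lemma hist_length {X : Type} (b : nat -> X) k : length (hist b k) = k.
Proof. unfold hist. now rewrite length_map, length_seq. Qed.

Lemma skipn_hist {X : Type} (b : nat -> X) i k :
  skipn i (hist b (i + k)) = hist (fun j => b (i + j)%nat) k.
Proof.
  revert b. induction i as [|i IH]; intros b; auto.
  rewrite plus_Sn_m, hist_cons. simpl. apply IH.
Qed.

(** Dependent choice in which each element may depend on all the earlier ones. *)
Lemma history_choice {X : Type} (P : list X -> X -> Prop) :
  (forall l, exists a, P l a) -> exists b, forall k, P (hist b k) (b k).
Proof.
  intros H. destruct (choice_fun _ H) as [next Hn].
  set (h := fix h k := match k with O => nil | S k' => h k' ++ next (h k') :: nil end).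
  exists (fun k => next (h k)). intros k.
  replace (hist (fun k => next (h k)) k) with (h k); auto.
  induction k as [|k IH]; auto. rewrite hist_S, <- IH. reflexivity.
Qed.

(** Banach-Alaoglu by ultralimits. If no finite list works, each list [L] has a functional [F L] in
    the ball that is at least [e] on the elements of [L] in [V]. A limit of the [F L] along an
    ultrafilter on lists is in the ball and is at least [e] on all of [V]. *)
Lemma dball_compact (E : Frechet) m (V : E -> Prop) e :
  (forall f, dball E m f -> exists a, V a /\ ev E f a < e) ->
  exists L, forall f, dball E m f -> exists a, In a L /\ V a /\ ev E f a < e.
Proof.
  intros HV. apply NNPP. intros N.
  assert (K : forall L : list E, exists f, dball E m f /\ forall a, In a L -> V a -> e <= ev E f a).
  { intros L. apply NNPP. intros NL. apply N. exists L. intros f Hf. apply NNPP. intros Na.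
    apply NL. exists f. split; auto. intros a Ha Va. apply Rnot_lt_le. intros Hlt.
    apply Na. now exists a. }
  destruct (choice_fun _ K) as [F HF].
  (* The ultrafilter contains, for each [a], the set of lists through [a]; finitely many such
     conditions are met by one list. *)
  destruct (ultrafilter_exists (fun S : list E -> Prop => exists a, S = fun L => In a L))
    as [U [HU HUF]].
  { intros L. induction L as [|S L IH]; intros HL.
    - exists nil. intros S [].
    - destruct IH as [l Hl]; [intros S' HS'; apply HL; now right|].
      assert (HS : exists a, S = fun L => In a L) by (apply HL; now left).
      destruct HS as [a ->]. exists (a :: l).
      intros S' [<-|HS']; [now left|].
      destruct (HL S' (or_intror HS')) as [a' ->]. right.
      exact (Hl _ HS'). }
  destruct (choice_fun (fun x r => forall d, 0 < d -> U (fun L => Rabs (ev E (F L) x - r) < d)))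
    as [g Hg].
  { intros x. apply ultralimit_exists with (INR m * maxsem E m x); auto.
    intros L. apply (HF L). }
  assert (lin : is_linear E g).
  { split.
    - intros x y. apply Rminus_diag_uniq. apply NNPP. intros Hne.
      assert (Hd : 0 < Rabs (g (x [+] y) - (g x + g y)) / 3).
      { apply Rabs_pos_lt in Hne. lra. }
      set (d := Rabs (g (x [+] y) - (g x + g y)) / 3) in *.
      destruct (uf_ex U HU _ (uf_and U HU _ _ (Hg (x [+] y) d Hd)
                  (uf_and U HU _ _ (Hg x d Hd) (Hg y d Hd)))) as [L [H1 [H2 H3]]].
      rewrite ev_add in H1. apply Rabs_def2 in H1. apply Rabs_def2 in H2. apply Rabs_def2 in H3.
      assert (Rabs (g (x [+] y) - (g x + g y)) < 3 * d) by (apply Rabs_def1; lra).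
      unfold d in *. lra.
    - intros c x. apply Rminus_diag_uniq. apply NNPP. intros Hne.
      assert (Hp : 0 < Rabs (g (c [*] x) - c * g x)) by now apply Rabs_pos_lt.
      set (s := Rabs (g (c [*] x) - c * g x)) in *.
      pose proof (Rabs_pos c) as Hc.
      assert (Hd : 0 < s / (2 * (Rabs c + 1))) by (apply Rdiv_lt_0_compat; lra).
      destruct (uf_ex U HU _ (uf_and U HU _ _ (Hg (c [*] x) (s / 2) ltac:(lra))
                  (Hg x _ Hd))) as [L [H1 H2]].
      rewrite ev_scal in H1.
      assert (H3 : Rabs c * Rabs (ev E (F L) x - g x) <= s / 2).
      { apply Rle_trans with ((Rabs c + 1) * (s / (2 * (Rabs c + 1)))).
        - apply Rmult_le_compat; try apply Rabs_pos; lra.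
        - apply Req_le. field. lra. }
      rewrite <- Rabs_mult in H3.
      assert (s <= Rabs (c * ev E (F L) x - g (c [*] x)) + Rabs (c * (ev E (F L) x - g x))).
      { unfold s. rewrite <- (Rabs_Ropp (c * ev E (F L) x - g (c [*] x))).
        replace (g (c [*] x) - c * g x) with
          (- (c * ev E (F L) x - g (c [*] x)) + c * (ev E (F L) x - g x)) by ring.
        apply Rabs_triang. }
      lra. }
  assert (bnd : forall x, Rabs (g x) <= INR m * maxsem E m x).
  { intros x. apply Rle_plus_epsilon. intros d Hd.
    destruct (uf_ex U HU _ (Hg x d Hd)) as [L HL].
    pose proof (proj1 (HF L) x) as H1.
    replace (g x) with (ev E (F L) x + - (ev E (F L) x - g x)) by ring.
    apply Rle_trans with (1 := Rabs_triang _ _). rewrite Rabs_Ropp. lra. }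
  set (f := exist _ g (conj lin (ex_intro _ m (ex_intro _ (INR m) bnd))) : dual E).
  destruct (HV f bnd) as [a [Va Ha]]. change (ev E f a) with (g a) in Ha.
  destruct (uf_ex U HU _ (uf_and U HU _ _ (Hg a (e - g a) ltac:(lra))
              (HUF _ (ex_intro _ a eq_refl)))) as [L [H1 H2]].
  pose proof (proj2 (HF L) a H2 Va). apply Rabs_def2 in H1. lra.
Qed.

(* Player I plays sets of the ultrafilter [U], player II elements [b k] of them; [small]
   says that player I can prevent every [f] in [C] from satisfying [e <= f (b k)]
   infinitely often. *)
Definition small (E : Frechet) (U : (E -> Prop) -> Prop) (e : R) (C : dual E -> Prop) : Prop :=
  exists sig : list E -> E -> Prop, (forall l, U (sig l)) /\
    forall b, (forall k, sig (hist b k) (b k)) ->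
    forall f, C f -> exists N, forall k, (N <= k)%nat -> ev E f (b k) < e.

Lemma small_sub (E : Frechet) U e (C D : dual E -> Prop) :
  small E U e D -> (forall f, C f -> D f) -> small E U e C.
Proof.
  intros [sig [H1 H2]] H. exists sig. split; [exact H1|].
  intros b Hb f Cf. apply (H2 b Hb f). auto.
Qed.

Lemma small_empty (E : Frechet) U e (C : dual E -> Prop) :
  ultrafilter U -> (forall f, ~ C f) -> small E U e C.
Proof.
  intros HU H. exists (fun _ _ => True). split.
  - intros l. now apply ultrafilter_true.
  - intros b _ f Cf. now destruct (H f).
Qed.

(** Player I plays the intersection of the sets given by both strategies, so every play obeys each
    of them. *)
Lemma small_or (E : Frechet) U e (C D : dual E -> Prop) :
  ultrafilter U -> small E U e C -> small E U e D -> small E U e (fun f => C f \/ D f).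
Proof.
  intros HU [s [Hs1 Hs2]] [t [Ht1 Ht2]]. exists (fun l a => s l a /\ t l a). split.
  - intros l. now apply (uf_and U HU).
  - intros b Hb f [Cf|Df].
    + apply (Hs2 b); auto. intros k. apply Hb.
    + apply (Ht2 b); auto. intros k. apply Hb.
Qed.

Lemma small_list (E : Frechet) U e (I : Type) (C : I -> dual E -> Prop) (L : list I) :
  ultrafilter U -> (forall i, In i L -> small E U e (C i)) ->
  small E U e (fun f => exists i, In i L /\ C i f).
Proof.
  intros HU. induction L as [|i L IH]; intros H.
  - apply small_empty; auto. intros f [i [[] _]].
  - apply small_sub with (fun f => C i f \/ exists j, In j L /\ C j f).
    + apply small_or; auto.
      * apply H. now left.
      * apply IH. intros j Hj. apply H. now right.
    + intros f [j [[<-|Hj] Cf]]; auto. right. now exists j.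
Qed.

(* On her [i]-th move player I also starts, from the position reached, a strategy for the
   functionals with [e <= f (b i)]. *)
Lemma big_step_ge (E : Frechet) U e (C : dual E -> Prop) :
  ultrafilter U -> ~ small E U e C ->
  U (fun a => ~ small E U e (fun f => e <= ev E f a /\ C f)).
Proof.
  intros HU HC.
  destruct (uf_em U HU (fun a => small E U e (fun f => e <= ev E f a /\ C f))) as [HV|HV]; auto.
  exfalso. apply HC. clear HC.
  set (V := fun a => small E U e (fun f => e <= ev E f a /\ C f)) in *.
  destruct (choice_fun (fun a (sig : list E -> E -> Prop) => (forall l, U (sig l)) /\
    (V a -> forall b, (forall k, sig (hist b k) (b k)) ->
      forall f, e <= ev E f a /\ C f -> exists N, forall k, (N <= k)%nat -> ev E f (b k) < e)))
    as [sig Hsig].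
  { intros a. destruct (classic (V a)) as [[s [H1 H2]]|Va].
    - now exists s.
    - exists (fun _ _ => True). split; [|tauto]. intros l. now apply ultrafilter_true. }
  set (tau := fix tau (l : list E) (x : E) : Prop :=
    match l with nil => V x | a :: t => sig a t x /\ tau t x end).
  assert (HtauU : forall l, U (tau l)).
  { induction l as [|a l IH]; [exact HV|].
    apply (uf_and U HU); auto. apply Hsig. }
  exists tau. split; auto. intros b Hb f Cf.
  (* A play obeying [tau] still obeys it after its first [i] moves are dropped, so the strategy
     started by move [b i] is followed from move [i + 1] on. *)
  assert (shift : forall i k, tau (hist (fun j => b (i + j)%nat) k) (b (i + k)%nat)).
  { induction i as [|i IH]; intros k; [apply Hb|].
    specialize (IH (S k)). rewrite hist_cons in IH. destruct IH as [_ IH].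
    replace (fun j => b (S i + j)%nat) with (fun j => b (i + S j)%nat).
    - replace (S i + k)%nat with (i + S k)%nat by lia. exact IH.
    - apply functional_extensionality. intros j. f_equal. lia. }
  destruct (classic (exists i, e <= ev E f (b i))) as [[i Hi]|Hn].
  - destruct (proj2 (Hsig (b i))) with (b := fun j => b (S i + j)%nat) (f := f) as [N HN]; auto.
    + specialize (shift i O). rewrite Nat.add_0_r in shift. exact shift.
    + intros k. specialize (shift i (S k)). rewrite hist_cons in shift.
      destruct shift as [H _]. rewrite Nat.add_0_r in H.
      replace (fun j => b (S i + j)%nat) with (fun j => b (i + S j)%nat).
      * replace (S i + k)%nat with (i + S k)%nat by lia. exact H.
      * apply functional_extensionality. intros j. f_equal. lia.
    + exists (S i + N)%nat. intros k Hk. specialize (HN (k - S i)%nat ltac:(lia)).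
      replace (S i + (k - S i))%nat with k in HN by lia. exact HN.
  - exists O. intros k _. apply Rnot_le_lt. intros H. apply Hn. now exists k.
Qed.

(** Otherwise the set [V] of the [a] with a small remainder belongs to [U]. Since [U] converges
    weakly to zero, each [f] in the ball has some [a] in [V] with [f a < r]. By compactness finitely
    many [a] suffice, which makes [C] a finite union of small sets. *)
Lemma big_step_le (E : Frechet) U e r m (C : dual E -> Prop) :
  ultrafilter U -> (forall f d, 0 < d -> U (fun a => Rabs (ev E f a) < d)) ->
  0 < r -> (forall f, C f -> dball E m f) -> ~ small E U e C ->
  U (fun a => ~ small E U e (fun f => ev E f a <= r /\ C f)).
Proof.
  intros HU HUw Hr Cm HC.
  destruct (uf_em U HU (fun a => small E U e (fun f => ev E f a <= r /\ C f))) as [HV|HV]; auto.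
  exfalso. apply HC. clear HC.
  set (V := fun a => small E U e (fun f => ev E f a <= r /\ C f)) in *.
  destruct (dball_compact E m V r) as [L HL].
  { intros f _. destruct (uf_ex U HU _ (uf_and U HU _ _ HV (HUw f r Hr))) as [a [Va Ha]].
    exists a. split; auto. apply Rabs_def2 in Ha. lra. }
  apply small_sub with (fun f => exists a, In a L /\ (V a /\ ev E f a <= r /\ C f)).
  - apply small_list; auto. intros a Ha. destruct (classic (V a)) as [Va|Va].
    + apply small_sub with (1 := Va). tauto.
    + apply small_empty; auto. tauto.
  - intros f Cf. destruct (HL f (Cm f Cf)) as [a [H1 [H2 H3]]]. exists a.
    repeat split; auto. lra.
Qed.

Lemma bool_lists_finite n : exists L : list (list bool), forall M, length M = n -> In M L.
Proof.
  induction n as [|n [L HL]].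
  - exists (nil :: nil). intros [|s M] H; [now left|discriminate].
  - exists (map (cons true) L ++ map (cons false) L). intros [|s M] H; [discriminate|].
    injection H as H. apply HL in H. apply in_or_app.
    destruct s; [left|right]; now apply in_map.
Qed.

(** The history is read newest first, so that a new move adds one constraint at the head. *)
Fixpoint cell (E : Frechet) (m : nat) (e : R) (h : list E) (M : list bool) (f : dual E) : Prop :=
  match h, M with
  | a :: h', s :: M' => (if s then e <= ev E f a else ev E f a <= e / 2) /\ cell E m e h' M' f
  | _, _ => dball E m f
  end.

Lemma cell_dball (E : Frechet) m e h M f : cell E m e h M f -> dball E m f.
Proof.
  revert M. induction h as [|a h IH]; intros [|s M]; simpl; auto.
  intros [_ H]. eauto.
Qed.

(** The invariant [Inv] keeps all cells of the current history big. There are finitely many cells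
    and each splitting step succeeds for [U]-almost all [a], so one [a] in [B] splits them all. At
    the end, a big cell is non-empty. *)
Lemma independent_sequence (E : Frechet) U (B : E -> Prop) e m :
  ultrafilter U -> (forall f d, 0 < d -> U (fun a => Rabs (ev E f a) < d)) -> U B ->
  0 < e -> ~ small E U e (dball E m) ->
  exists b : nat -> E, (forall k, B (b k)) /\
    forall n (M : nat -> bool), exists f, dball E m f /\ forall k, (k < n)%nat ->
     if M k then e <= ev E f (b k) else ev E f (b k) <= e / 2.
Proof.
  intros HU HUw UB He Hbig.
  set (Inv := fun h => forall M, length M = length h -> ~ small E U e (cell E m e h M)).
  destruct (history_choice (fun l a => Inv (rev l) -> B a /\ Inv (a :: rev l))) as [b Hb].
  { intros l. destruct (classic (Inv (rev l))) as [Hl|Hl]; [|exists (v0 E); tauto].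
    destruct (bool_lists_finite (length (rev l))) as [L HL].
    destruct (uf_ex U HU (fun a => B a /\ forall M, In M L -> length M = length (rev l) ->
      ~ small E U e (fun f => e <= ev E f a /\ cell E m e (rev l) M f) /\
      ~ small E U e (fun f => ev E f a <= e / 2 /\ cell E m e (rev l) M f))) as [a [Ba Ha]].
    { apply (uf_and U HU); auto. apply ultrafilter_list_and; auto.
      intros M _. destruct (classic (length M = length (rev l))) as [E1|E1].
      - apply (uf_up U HU (fun a =>
          ~ small E U e (fun f => e <= ev E f a /\ cell E m e (rev l) M f) /\
          ~ small E U e (fun f => ev E f a <= e / 2 /\ cell E m e (rev l) M f))).
        + apply (uf_and U HU).
          * apply big_step_ge; auto.
          * apply big_step_le with m; auto; [lra|]. intros f. apply cell_dball.
        + auto.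
      - apply ultrafilter_true; tauto. }
    exists a. intros _. split; auto. intros [|s M] HM; [discriminate|].
    injection HM as HM. destruct (Ha M) as [H1 H2]; auto. destruct s; auto. }
  assert (HInv : forall k, Inv (rev (hist b k))).
  { induction k as [|k IH].
    - intros [|s M] HM; [exact Hbig|discriminate].
    - rewrite hist_S, rev_app_distr. now apply Hb. }
  exists b. split; [intros k; now apply Hb|].
  intros n M.
  assert (K : exists f, cell E m e (rev (hist b n)) (rev (hist M n)) f).
  { apply NNPP. intros N. apply (HInv n (rev (hist M n))).
    - now rewrite !length_rev, !hist_length.
    - apply small_empty; auto. intros f Hf. apply N. now exists f. }
  destruct K as [f Hf]. exists f. split; [eapply cell_dball; eauto|].
  induction n as [|n IH]; [intros k Hk; lia|].
  rewrite !hist_S, !rev_app_distr in Hf. destruct Hf as [H1 H2].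
  intros k Hk. destruct (Nat.eq_dec k n) as [->|Hn]; auto.
  apply IH; auto. lia.
Qed.

Definition weakly_null (E : Frechet) (b : nat -> E) : Prop :=
  forall f r, 0 < r -> exists N, forall k, (N <= k)%nat -> Rabs (ev E f (b k)) < r.

Theorem weakly_null_selection (E : Frechet) (B : E -> Prop) (A : nat -> E -> Prop) :
  ~ contains_l1 E -> E_bounded E B ->
  (forall k x, A k x -> B x) -> (forall k x, A (S k) x -> A k x) ->
  (forall k L r, 0 < r -> exists x, A k x /\ forall f, In f L -> Rabs (ev E f x) < r) ->
  exists b, (forall k, A k (b k)) /\ weakly_null E b.
Proof.
  intros Nl1 HB AB Adec Acl.
  assert (Amono : forall i j x, (i <= j)%nat -> A j x -> A i x).
  { intros i j x H. induction H; auto. }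
  destruct (ultrafilter_exists (fun S : E -> Prop => (exists k, S = A k) \/
      exists f r, 0 < r /\ S = fun x => Rabs (ev E f x) < r)) as [U [HU HUF]].
  { intros L HL.
    assert (K : exists k Lf r, 0 < r /\ forall x, A k x ->
        (forall f, In f Lf -> Rabs (ev E f x) < r) -> forall S, In S L -> S x).
    { induction L as [|S L IH].
      - exists O, nil, 1. split; [lra|]. intros x _ _ S [].
      - destruct IH as [k [Lf [r [Hr H]]]]; [intros S' HS'; apply HL; now right|].
        assert (HS := HL S (or_introl eq_refl)).
        destruct HS as [[k' ->]|[f [r' [Hr' ->]]]].
        + exists (Nat.max k k'), Lf, r. split; auto. intros x Ax Hx S [<-|HS].
          * apply Amono with (2 := Ax). lia.
          * apply H; auto. apply Amono with (2 := Ax). lia.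
        + exists k, (f :: Lf), (Rmin r r'). split; [now apply Rmin_glb_lt|].
          intros x Ax Hx S [<-|HS].
          * apply Rlt_le_trans with (2 := Rmin_r r r'). apply Hx. now left.
          * apply H; auto. intros g Hg. apply Rlt_le_trans with (2 := Rmin_l r r').
            apply Hx. now right. }
    destruct K as [k [Lf [r [Hr H]]]]. destruct (Acl k Lf r Hr) as [x [Ax Hx]].
    exists x. apply H; auto. }
  assert (HUw : forall f d, 0 < d -> U (fun a => Rabs (ev E f a) < d)).
  { intros f d Hd. apply HUF. right. now exists f, d. }
  assert (HUA : forall k, U (A k)) by (intros k; apply HUF; left; now exists k).
  assert (pos : forall i, 0 < / INR (S i)).
  { intros i. apply Rinv_0_lt_compat, lt_0_INR. lia. }
  (* A ball that is not small would yield an independent sequence inside [A O], hence in [B], and so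
     a copy of l1. *)
  assert (small_all : forall i, small E U (/ INR (S i)) (dball E i)).
  { intros i. apply NNPP. intros N. apply Nl1.
    destruct (independent_sequence E U (A O) (/ INR (S i)) i) as [b [Hb Hind]]; auto.
    apply (contains_l1_of_independent E b i (/ INR (S i))); auto.
    intros n. destruct (HB n) as [M HM]. exists M. intros x [k ->]. apply HM.
    now apply (AB O). }
  destruct (choice_fun _ small_all) as [sig Hsig].
  (* The strategy for [dball E i] is joined only at move [i] and sees only the moves from there on.
     Each move thus answers finitely many strategies, and their sets have a common point in
     [A (length l)]. *)
  destruct (history_choice (fun l a => A (length l) a /\
    forall i, (i < S (length l))%nat -> sig i (skipn i l) a)) as [b Hb].
  { intros l. apply (uf_ex U HU). apply (uf_and U HU); auto.
    apply ultrafilter_bounded_and; auto. intros i _. apply Hsig. }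
  assert (upper : forall f r, 0 < r -> exists N, forall k, (N <= k)%nat -> ev E f (b k) < r).
  { intros f r Hr. destruct (dball_ex E f) as [m Hm].
    destruct (archimed_cor1 r Hr) as [j [Hj Hj0]].
    (* This index puts [f] in [dball E i] and makes the threshold [/ INR (S i)] less than [r]. *)
    set (i := (m + j)%nat).
    destruct (proj2 (Hsig i) (fun k => b (i + k)%nat)) with (f := f) as [N HN].
    - intros k. rewrite <- skipn_hist. apply Hb. rewrite hist_length. lia.
    - apply dball_mono with (2 := Hm). lia.
    - exists (i + N)%nat. intros k Hk. specialize (HN (k - i)%nat ltac:(lia)).
      replace (i + (k - i))%nat with k in HN by lia.
      apply Rlt_trans with (1 := HN). apply Rle_lt_trans with (2 := Hj).
      apply Rinv_le_contravar; [apply lt_0_INR; lia|apply le_INR; lia]. }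
  exists b. split.
  - intros k. destruct (Hb k) as [H _]. now rewrite hist_length in H.
  - intros f r Hr. destruct (upper f r Hr) as [N HN].
    destruct (upper (daxpy E (-2) f f) r Hr) as [N' HN'].
    exists (N + N')%nat. intros k Hk.
    specialize (HN k ltac:(lia)). specialize (HN' k ltac:(lia)). simpl in HN'.
    apply Rabs_def1; lra.
Qed.

(** * From sigma-locally finite k-networks to separability of the strong dual *)

Lemma eventually_list {I : Type} (P : I -> nat -> Prop) (L : list I) :
  (forall i, In i L -> exists N, forall k, (N <= k)%nat -> P i k) ->
  exists N, forall k, (N <= k)%nat -> forall i, In i L -> P i k.
Proof.
  induction L as [|i L IH]; intros H.
  - exists O. intros k _ i [].
  - destruct IH as [N HN]; [intros j Hj; apply H; now right|].
    destruct (H i (or_introl eq_refl)) as [N' HN'].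
    exists (N + N')%nat. intros k Hk j [<-|Hj]; [apply HN'|apply HN]; auto; lia.
Qed.

Lemma weakly_null_eventually (E : Frechet) b (W : E -> Prop) :
  weakly_null E b -> weak_open E W -> W (v0 E) ->
  exists N, forall k, (N <= k)%nat -> W (b k).
Proof.
  intros Hb HW W0. destruct (HW _ W0) as [L [r [Hr H]]].
  destruct (eventually_list (fun f k => Rabs (ev E f (b k)) < r) L) as [N HN].
  - intros f _. now apply Hb.
  - exists N. intros k Hk. apply H. intros f Hf. rewrite vsub_0r. auto.
Qed.

Lemma weakly_null_compact (E : Frechet) b :
  weakly_null E b -> Defs.compact E (weak_open E) (fun x => x = v0 E \/ exists k, x = b k).
Proof.
  intros Hb cov Hopen Hcov.
  destruct (Hcov (v0 E) (or_introl eq_refl)) as [W [CW W0]].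
  destruct (weakly_null_eventually E b W Hb (Hopen W CW) W0) as [N HN].
  assert (K : exists L, (forall V, In V L -> cov V) /\
                forall k, (k < N)%nat -> exists V, In V L /\ V (b k)).
  { clear HN. induction N as [|N [L [H1 H2]]].
    - exists nil. split; [intros V []|intros k Hk; lia].
    - destruct (Hcov (b N)) as [V [CV Vb]]; [right; now exists N|].
      exists (V :: L). split; [intros V' [<-|H']; auto|].
      intros k Hk. destruct (Nat.eq_dec k N) as [->|Hn].
      + exists V. split; [now left|auto].
      + destruct (H2 k ltac:(lia)) as [V' [H3 H4]]. exists V'. split; [now right|auto]. }
  destruct K as [L [H1 H2]]. exists (W :: L). split; [intros V [<-|H']; auto|].
  intros x [->|[k ->]].
  - exists W. split; [now left|auto].
  - destruct (Nat.lt_ge_cases k N) as [Hk|Hk].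
    + destruct (H2 k Hk) as [V [H3 H4]]. exists V. split; [now right|auto].
    + exists W. split; [now left|auto].
Qed.

(* Only the countably many members of the network that meet neighbourhoods [W k] of [0]
   witnessing local finiteness matter for tails of weakly null sequences. If no finite
   union of those inside [U] were a neighbourhood of [0] in [B], then
   [weakly_null_selection] would produce a weakly null sequence in [B] escaping all of
   these unions. *)
Lemma weakly_aleph_countable_base (E : Frechet) (B : E -> Prop) :
  ~ contains_l1 E -> weakly_aleph_space E -> E_bounded E B ->
  exists G : nat -> list (dual E), forall f e, 0 < e ->
    exists n, forall x, B x -> (forall g, In g (G n) -> ev E g x = 0) -> Rabs (ev E f x) < e.
Proof.
  intros Nl1 [_ [N [Nk [Ns [Nlf NsE]]]]] HB.
  destruct (choice_fun (fun k (WL : (E -> Prop) * list (E -> Prop)) =>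
    weak_open E (fst WL) /\ fst WL (v0 E) /\
    forall S, Ns k S -> (exists y, fst WL y /\ S y) -> In S (snd WL))) as [WL HWL].
  { intros k. destruct (Nlf k (v0 E)) as [W [HW [W0 [L HL]]]]. now exists (W, L). }
  (* One enumeration of all the finite lists [snd (WL k)]; positions past the end of a list give the
     empty set. *)
  set (enum := fun p => let (k, j) := Cantor.of_nat p in
                 nth j (snd (WL k)) (fun _ : E => False)).
  assert (enum_all : forall k S, In S (snd (WL k)) -> exists p, enum p = S).
  { intros k S HS. destruct (In_nth _ _ (fun _ => False) HS) as [j [_ Hj]].
    exists (Cantor.to_nat (k, j)). unfold enum. now rewrite Cantor.cancel_of_to. }
  destruct nat_lists_countable as [dec Hdec].
  set (Cov := fun (l : list nat) x => exists p, In p l /\ enum p x).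
  set (nbhd := fun l (Lf : list (dual E)) => exists r, 0 < r /\
    forall x, B x -> (forall g, In g Lf -> Rabs (ev E g x) < r) -> Cov l x).
  (* [G] is fixed before [f] and [e] are given: it depends only on which finite unions of enumerated
     sets are neighbourhoods of zero in [B]. *)
  destruct (choice_fun (fun n Lf => (exists Lf', nbhd (dec n) Lf') -> nbhd (dec n) Lf))
    as [G HG].
  { intros n. destruct (classic (exists Lf', nbhd (dec n) Lf')) as [[Lf H]|H].
    - now exists Lf.
    - exists nil. tauto. }
  exists G. intros f e He.
  set (U := fun x => Rabs (ev E f x) < e).
  (* The indices below [i] of enumerated sets inside [U]. The unions [Cov (l i)] increase with [i],
     so their complements form the decreasing sequence required for the selection. *)
  set (l := fun i => filter (fun p => if excluded_middle_informative (forall x, enum p x -> U x)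
                                      then true else false) (seq 0 i)).
  assert (lE : forall i p, In p (l i) <-> (p < i)%nat /\ forall x, enum p x -> U x).
  { intros i p. unfold l. rewrite filter_In, in_seq.
    destruct (excluded_middle_informative (forall x, enum p x -> U x)) as [H|H]; split.
    - intros [H1 _]. split; auto. lia.
    - intros [H1 _]. split; auto. lia.
    - intros [_ H1]. discriminate.
    - tauto. }
  assert (K : exists i Lf, nbhd (l i) Lf).
  { apply NNPP. intros Hno.
    destruct (weakly_null_selection E B (fun i x => B x /\ U x /\ ~ Cov (l i) x))
      as [b [Hb Hnull]]; auto.
    - tauto.
    - intros k x [H1 [H2 H3]]. repeat split; auto. intros [p [Hp Hx]]. apply H3.
      exists p. split; auto. apply lE. apply lE in Hp. split; [lia|tauto].
    - intros k L r Hr. apply NNPP. intros Hn. apply Hno. exists k, (f :: L).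
      exists (Rmin r e). split; [now apply Rmin_glb_lt|]. intros x Bx Hx.
      apply NNPP. intros HC. apply Hn. exists x. repeat split; auto.
      + apply Rlt_le_trans with (2 := Rmin_r r e). apply Hx. now left.
      + intros g Hg. apply Rlt_le_trans with (2 := Rmin_l r e). apply Hx. now right.
    - destruct (Nk _ U (weakly_null_compact E b Hnull)) as [F [FN [Fcov FU]]].
      + apply weak_open_ev_lt.
      + intros x [->|[k ->]]; [|apply Hb]. unfold U. now rewrite ev_0, Rabs_R0.
      (* A member of the finite cover [F] either is some [enum p], and then [p < i] from some [i]
         on, or it misses a tail of [b]: the tail lies in the neighbourhood [fst (WL k)], and every
         member of [Ns k] meeting it is enumerated. *)
      + destruct (eventually_list (fun S i => S (b i) -> exists p, (p < i)%nat /\ enum p = S) F)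
          as [M HM].
        * intros S HS. destruct (proj1 (NsE S) (FN S HS)) as [k Hk].
          destruct (HWL k) as [H1 [H2 H3]].
          destruct (weakly_null_eventually E b _ Hnull H1 H2) as [M HM].
          destruct (classic (exists p, enum p = S)) as [[p Hp]|Hp].
          -- exists (Datatypes.S p). intros i Hi _. exists p. split; auto.
          -- exists M. intros i Hi Sb. exfalso. apply Hp. apply (enum_all k).
             apply H3; auto. exists (b i). split; auto.
        * destruct (Fcov (b M)) as [S [HS Sb]]; [right; now exists M|].
          destruct (HM M (le_n M) S HS Sb) as [p [Hp Ep]].
          destruct (Hb M) as [_ [_ H]]. apply H. exists p. split.
          -- apply lE. split; auto. rewrite Ep. apply FU; auto.
          -- now rewrite Ep. }
  destruct K as [i HK]. destruct (Hdec (l i)) as [n Hn].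
  exists n. intros x Bx Hx.
  destruct (HG n) as [r [Hr H]]; [now rewrite Hn|].
  destruct (H x Bx) as [p [Hp Hpx]].
  - intros g Hg. rewrite (Hx g Hg), Rabs_R0. auto.
  - rewrite Hn in Hp. apply lE in Hp. now apply Hp.
Qed.

(** * Approximation by linear combinations on absolutely convex sets *)

Definition abs_convex (E : Frechet) (B : E -> Prop) : Prop :=
  forall x y s t, Rabs s + Rabs t <= 1 -> B x -> B y -> B (s [*] x [+] t [*] y).

Lemma bounded_in_abs_convex (E : Frechet) (B : E -> Prop) :
  E_bounded E B -> exists D, E_bounded E D /\ abs_convex E D /\ forall x, B x -> D x.
Proof.
  intros HB. destruct (choice_fun _ HB) as [M HM].
  exists (fun x => forall n, sem E n x <= M n). repeat split.
  - intros n. exists (M n). auto.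
  - intros x y s t Hst Hx Hy n.
    apply Rle_trans with (1 := sem_triangle _ _ _ _). rewrite !sem_homog.
    specialize (Hx n). specialize (Hy n).
    pose proof (Rabs_pos s). pose proof (Rabs_pos t). pose proof (sem_ge0 E n x). nra.
  - auto.
Qed.

(** The number [c] must separate the quotients [(f x - e) / g x] from the quotients
    [(f y + e) / g y], where [g] is positive at [x] and [y]. A supremum provides it once [cross] is
    known; negative values of [g] follow by symmetry of [B]. *)
Lemma abs_convex_separation (E : Frechet) (B : E -> Prop) (f g : dual E) e :
  abs_convex E B -> 0 <= e -> (forall x, B x -> ev E g x = 0 -> Rabs (ev E f x) <= e) ->
  exists c, forall x, B x -> Rabs (ev E f x - c * ev E g x) <= e.
Proof.
  intros HB He H.
  assert (Bopp : forall x, B x -> B ((-1) [*] x)).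
  { intros x Bx. rewrite <- (vadd0 E ((-1) [*] x)), <- (vscal_0l E x). apply HB; auto.
    replace (-1) with (-(1)) by lra. rewrite Rabs_Ropp, Rabs_R1, Rabs_R0. lra. }
  assert (cross : forall x y, B x -> B y -> 0 < ev E g x -> 0 < ev E g y ->
    (ev E f x - e) / ev E g x <= (ev E f y + e) / ev E g y).
  { intros x y Bx By gx gy.
    set (w := ev E g x + ev E g y).
    (* The combination is chosen in the kernel of [g], and the absolute values of its coefficients
       add up to 1. *)
    assert (Hz : Rabs (ev E f ((ev E g y / w) [*] x [+] (- (ev E g x / w)) [*] y)) <= e).
    { apply H.
      - apply HB; auto. rewrite Rabs_Ropp, !Rabs_pos_eq.
        + apply Req_le. unfold w. field. lra.
        + left. apply Rdiv_lt_0_compat; unfold w; lra.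
        + left. apply Rdiv_lt_0_compat; unfold w; lra.
      - rewrite ev_add, !ev_scal. unfold w. field. lra. }
    rewrite ev_add, !ev_scal in Hz.
    apply Rle_trans with (1 := Rle_abs _) in Hz.
    assert (K : ev E f x * ev E g y - ev E f y * ev E g x <= e * w).
    { apply Rmult_le_compat_r with (r := w) in Hz; [|unfold w; lra].
      replace (ev E f x * ev E g y - ev E f y * ev E g x) with
        ((ev E g y / w * ev E f x + - (ev E g x / w) * ev E f y) * w); auto.
      unfold w. field. lra. }
    unfold w in K.
    apply Rmult_le_reg_r with (ev E g x * ev E g y); [now apply Rmult_lt_0_compat|].
    replace ((ev E f x - e) / ev E g x * (ev E g x * ev E g y))
      with ((ev E f x - e) * ev E g y) by (field; lra).
    replace ((ev E f y + e) / ev E g y * (ev E g x * ev E g y))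
      with ((ev E f y + e) * ev E g x) by (field; lra). lra. }
  destruct (classic (exists y, B y /\ 0 < ev E g y)) as [[y [By gy]]|Hno].
  - destruct (completeness (fun t => exists x, B x /\ 0 < ev E g x /\
                              t = (ev E f x - e) / ev E g x)) as [c [Hub Hlub]].
    + exists ((ev E f y + e) / ev E g y). intros t [x [Bx [gx ->]]]. auto.
    + exists ((ev E f y - e) / ev E g y), y. auto.
    + assert (posc : forall x, B x -> 0 < ev E g x -> Rabs (ev E f x - c * ev E g x) <= e).
      { intros x Bx gx.
        assert (H1 : (ev E f x - e) / ev E g x <= c) by (apply Hub; now exists x).
        assert (H2 : c <= (ev E f x + e) / ev E g x).
        { apply Hlub. intros t [z [Bz [gz ->]]]. auto. }
        apply Rmult_le_compat_r with (r := ev E g x) in H1, H2; try lra.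
        unfold Rdiv in H1, H2. rewrite Rmult_assoc, Rinv_l, Rmult_1_r in H1, H2 by lra.
        apply Rabs_le. lra. }
      exists c. intros x Bx. destruct (Rtotal_order (ev E g x) 0) as [Hx|[Hx|Hx]].
      * specialize (posc _ (Bopp x Bx)). rewrite !ev_scal in posc.
        rewrite <- Rabs_Ropp. replace (- (ev E f x - c * ev E g x))
          with (-1 * ev E f x - c * (-1 * ev E g x)) by ring.
        apply posc. lra.
      * rewrite Hx, Rmult_0_r, Rminus_0_r. auto.
      * auto.
  - exists 0. intros x Bx. rewrite Rmult_0_l, Rminus_0_r. apply H; auto.
    destruct (Rtotal_order (ev E g x) 0) as [Hx|[Hx|Hx]]; auto.
    + exfalso. apply Hno. exists ((-1) [*] x). split; auto. rewrite ev_scal. lra.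
    + exfalso. apply Hno. now exists x.
Qed.

Fixpoint lincomb (E : Frechet) (q : nat -> R) (l : list nat) (gs : list (dual E)) : dual E :=
  match l, gs with
  | i :: l', g :: gs' => daxpy E (q i) g (lincomb E q l' gs')
  | _, _ => dzero E
  end.

(** Induction on [gs]: on the trace of [B] on the kernel of [g], which is again absolutely convex,
    the remaining functionals suffice. Separation then supplies the coefficient of [g]. Half of [d]
    pays for the trace, half for moving the coefficient into the sequence [q]. *)
Lemma lincomb_approx (E : Frechet) (q : nat -> R) (gs : list (dual E)) :
  (forall r e, 0 < e -> exists n, Rabs (q n - r) < e) ->
  forall (B : E -> Prop) f e d, E_bounded E B -> abs_convex E B -> 0 <= e -> 0 < d ->
  (forall x, B x -> (forall g, In g gs -> ev E g x = 0) -> Rabs (ev E f x) <= e) ->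
  exists l, forall x, B x -> Rabs (ev E f x - ev E (lincomb E q l gs) x) <= e + d.
Proof.
  intros Hq. induction gs as [|g gs IH]; intros B f e d HB Bc He Hd H.
  - exists nil. intros x Bx. simpl. rewrite Rminus_0_r. specialize (H x Bx).
    assert (Rabs (ev E f x) <= e); [|lra]. apply H. intros g [].
  - destruct (IH (fun x => B x /\ ev E g x = 0) f e (d / 2)) as [l Hl]; auto; try lra.
    + intros n. destruct (HB n) as [M HM]. exists M. intros x [Bx _]. auto.
    + intros x y s t Hst [Bx gx] [By gy]. split; [now apply Bc|].
      rewrite ev_add, !ev_scal, gx, gy. ring.
    + intros x [Bx gx] Hx. apply H; auto. intros g' [<-|Hg']; auto.
    + destruct (abs_convex_separation E B (daxpy E (-1) (lincomb E q l gs) f) g (e + d / 2))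
        as [c Hc]; auto; try lra.
      * intros x Bx gx. simpl.
        replace (ev E f x + -1 * ev E (lincomb E q l gs) x)
          with (ev E f x - ev E (lincomb E q l gs) x) by ring. auto.
      * destruct (dual_bounded_on E B g HB) as [M HM].
        pose proof (Rabs_pos M) as HM0. pose proof (Rle_abs M) as HM1.
        destruct (Hq c (d / (2 * (Rabs M + 1)))) as [i Hi].
        { apply Rdiv_lt_0_compat; lra. }
        exists (i :: l). intros x Bx. specialize (Hc x Bx). simpl in Hc |- *.
        specialize (HM x Bx).
        replace (ev E f x - (ev E (lincomb E q l gs) x + q i * ev E g x))
          with ((ev E f x + -1 * ev E (lincomb E q l gs) x - c * ev E g x)
                + - ((q i - c) * ev E g x)) by ring.
        apply Rle_trans with (1 := Rabs_triang _ _). rewrite Rabs_Ropp, Rabs_mult.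
        assert (Rabs (q i - c) * Rabs (ev E g x) <= d / 2); [|lra].
        apply Rle_trans with (d / (2 * (Rabs M + 1)) * (Rabs M + 1)).
        -- apply Rmult_le_compat; try apply Rabs_pos; lra.
        -- apply Req_le. field. lra.
Qed.

Lemma weakly_aleph_sup_separable (E : Frechet) (B : E -> Prop) :
  ~ contains_l1 E -> weakly_aleph_space E -> E_bounded E B ->
  exists s : nat -> dual E, forall f e, 0 < e ->
    exists n, forall x, B x -> Rabs (ev E f x - ev E (s n) x) <= e.
Proof.
  intros Nl1 Ha HB.
  destruct (bounded_in_abs_convex E B HB) as [D [HD [Dc BD]]].
  destruct (weakly_aleph_countable_base E D Nl1 Ha HD) as [G HG].
  destruct nat_lists_countable as [dec Hdec]. destruct dense_sequence as [q Hq].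
  exists (fun n => let (i, j) := Cantor.of_nat n in lincomb E q (dec j) (G i)).
  intros f e He. destruct (HG f (e / 2)) as [i Hi]; [lra|].
  destruct (lincomb_approx E q (G i) Hq D f (e / 2) (e / 2)) as [l Hl]; auto; try lra.
  { intros x Dx Hx. left. now apply Hi. }
  destruct (Hdec l) as [j Hj]. exists (Cantor.to_nat (i, j)).
  rewrite Cantor.cancel_of_to, Hj. intros x Bx. specialize (Hl x (BD x Bx)). lra.
Qed.

(** Each of the countably many bounded sets [B m k] has its own sequence of approximants. Closeness
    on a suitable [B m k] gives closeness on any bounded [C], but only between functionals in
    [dball E m]. *)
Theorem weakly_aleph_dual_separable (E : Frechet) :
  ~ contains_l1 E -> density_condition E -> weakly_aleph_space E -> strong_dual_separable E.
Proof.
  intros Nl1 DC Ha.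
  destruct (density_condition_countable E DC) as [B [e [HBe Hnet]]].
  destruct (choice_fun (fun mk (s : nat -> dual E) => forall f r, 0 < r ->
    exists n, forall x, B (fst mk) (snd mk) x -> Rabs (ev E f x - ev E (s n) x) <= r))
    as [s Hs].
  { intros [m k]. apply weakly_aleph_sup_separable; auto. apply HBe. }
  (* The approximants [s] need not lie in [dball m], so they are replaced by nearby
     points of that ball. *)
  destruct (choice_fun (fun p (g : dual E) => let (m, kj) := Cantor.of_nat p in
    let (k, j) := Cantor.of_nat kj in
    let near := fun h => dball E m h /\ forall x, B m k x ->
                  Rabs (ev E h x - ev E (s (m, k) j) x) <= e m k / 2 in
    (exists h, near h) -> near g)) as [g Hg].
  { intros p. destruct (Cantor.of_nat p) as [m kj]. destruct (Cantor.of_nat kj) as [k j]. cbv zeta.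
    match goal with |- exists b, (exists h, ?P h) -> _ =>
      destruct (classic (exists h, P h)) as [[h Hh]|Hno] end.
    - now exists h.
    - exists (dzero E). intros H. now destruct Hno. }
  exists g. intros U HU [f Uf]. destruct (HU f Uf) as [C [eps [HC [Heps H]]]].
  destruct (dball_ex E f) as [m Hm].
  destruct (Hnet m C eps HC Heps) as [k Hk].
  assert (He := proj2 (HBe m k)).
  destruct (Hs (m, k) f (e m k / 2)) as [j Hj]; [lra|]. simpl in Hj.
  set (p := Cantor.to_nat (m, Cantor.to_nat (k, j))).
  exists p. specialize (Hg p). unfold p in Hg at 1. rewrite !Cantor.cancel_of_to in Hg.
  destruct Hg as [Bg Hg]; [now exists f|].
  apply H. apply Hk; auto. intros x Bx. specialize (Hg x Bx). specialize (Hj x Bx).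
  rewrite Rabs_minus_sym in Hj.
  pose proof (Rabs_triang (ev E (g p) x - ev E (s (m, k) j) x)
                (ev E (s (m, k) j) x - ev E f x)) as T.
  replace (ev E (g p) x - ev E (s (m, k) j) x + (ev E (s (m, k) j) x - ev E f x))
    with (ev E (g p) x - ev E f x) in T by ring.
  lra.
Qed.

(** * Hahn-Banach and uniform boundedness *)

Definition sublinear (E : Frechet) (q : E -> R) : Prop :=
  (forall x y, q (x [+] y) <= q x + q y) /\ (forall t x, 0 <= t -> q (t [*] x) = t * q x).

Lemma sublinear_0 (E : Frechet) q : sublinear E q -> q (v0 E) = 0.
Proof.
  intros [_ H]. rewrite <- (vscal_0l E (v0 E)), H by lra. ring.
Qed.

Lemma sublinear_opp (E : Frechet) q x : sublinear E q -> - q ((-1) [*] x) <= q x.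
Proof.
  intros H. pose proof (proj1 H x ((-1) [*] x)) as K.
  rewrite <- vopp_scal, vaddN, (sublinear_0 E q H), vopp_scal in K. lra.
Qed.

(** The inequality for [t > 0] improves to an equality when it is also applied to [/ t] and [t [*]
    x]. *)
Lemma sublinear_intro (E : Frechet) (q : E -> R) :
  (forall x y, q (x [+] y) <= q x + q y) -> q (v0 E) = 0 ->
  (forall t x, 0 < t -> q (t [*] x) <= t * q x) -> sublinear E q.
Proof.
  intros Hadd H0 Hs. split; auto. intros t x Ht.
  destruct (Req_dec t 0) as [->|Ht0]; [now rewrite vscal_0l, H0, Rmult_0_l|].
  apply Rle_antisym; [apply Hs; lra|].
  assert (Hi : 0 < / t) by (apply Rinv_0_lt_compat; lra).
  pose proof (Hs (/ t) (t [*] x) Hi) as K.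
  rewrite vscalA, Rinv_l, vscal1 in K by auto.
  apply Rmult_le_compat_l with (r := t) in K; auto.
  rewrite <- Rmult_assoc, Rinv_r, Rmult_1_l in K; auto.
Qed.

Lemma pointwise_inf {I X : Type} (F : I -> X -> R) (i0 : I) (lb : X -> R) :
  (forall i x, lb x <= F i x) ->
  exists g, (forall i x, g x <= F i x) /\ forall x c, (forall i, c <= F i x) -> c <= g x.
Proof.
  intros H.
  destruct (choice_fun (fun x r => (forall i, r <= F i x) /\
                          forall c, (forall i, c <= F i x) -> c <= r)) as [g Hg].
  { intros x. destruct (completeness (fun t => exists i, t = - F i x)) as [s [H1 H2]].
    - exists (- lb x). intros t [i ->]. specialize (H i x). lra.
    - now exists (- F i0 x), i0.
    - exists (- s). split.
      + intros i. specialize (H1 (- F i x) (ex_intro _ i eq_refl)). lra.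
      + intros c Hc. assert (s <= - c); [|lra]. apply H2. intros t [i ->].
        specialize (Hc i). lra. }
  exists g. split.
  - intros i x. apply Hg.
  - intros x c Hc. now apply Hg.
Qed.

(* The witness is [x |-> inf_{t >= 0} (q (x + t y) - t q y)]. *)
Lemma sublinear_bend (E : Frechet) q (y : E) :
  sublinear E q ->
  exists q', sublinear E q' /\ (forall x, q' x <= q x) /\ forall x, q' x <= q (x [+] y) - q y.
Proof.
  intros Hq. pose proof Hq as [Hadd Hsc].
  destruct (pointwise_inf (fun (t : {t : R | 0 <= t}) x =>
              q (x [+] proj1_sig t [*] y) - proj1_sig t * q y)
              (exist _ 0 (Rle_refl 0)) (fun x => - q ((-1) [*] x))) as [g [Hle Hglb]].
  { intros [t Ht] x. simpl. rewrite <- (Hsc t y Ht).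
    pose proof (Hadd (x [+] t [*] y) ((-1) [*] x)) as K.
    rewrite (vaddC E x), <- vaddA, <- vopp_scal, vaddN, vadd0, vopp_scal in K.
    rewrite (vaddC E x). lra. }
  assert (Hle' : forall t x, 0 <= t -> g x <= q (x [+] t [*] y) - t * q y).
  { intros t x Ht. exact (Hle (exist _ t Ht) x). }
  assert (gq : forall x, g x <= q x).
  { intros x. pose proof (Hle' 0 x ltac:(lra)) as K. rewrite vscal_0l, vadd0 in K. lra. }
  exists g. split; [|split; auto].
  - apply sublinear_intro.
    + intros x z.
      assert (g (x [+] z) - g z <= g x); [|lra].
      apply Hglb. intros [t Ht]. simpl.
      assert (g (x [+] z) - (q (x [+] t [*] y) - t * q y) <= g z); [|lra].
      apply Hglb. intros [s Hs]. simpl.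
      pose proof (Hle' (t + s) (x [+] z) ltac:(lra)) as K.
      rewrite vscalDl, vadd_swap in K.
      pose proof (Hadd (x [+] t [*] y) (z [+] s [*] y)). lra.
    + apply Rle_antisym.
      * rewrite <- (sublinear_0 E q); [apply gq|now split].
      * apply Hglb. intros [t Ht]. simpl. rewrite vadd_0l, (Hsc t y Ht). lra.
    + intros t x Ht.
      assert (K : / t * g (t [*] x) <= g x).
      { apply Hglb. intros [s Hs]. simpl.
        pose proof (Hle' (t * s) (t [*] x) ltac:(nra)) as K.
        rewrite <- vscalA, <- vscalDr, Hsc in K by lra.
        apply Rmult_le_compat_l with (r := / t) in K;
          [|left; now apply Rinv_0_lt_compat].
        replace (/ t * (t * q (x [+] s [*] y) - t * s * q y))
          with (q (x [+] s [*] y) - s * q y) in K by (field; lra). exact K. }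
      apply Rmult_le_compat_l with (r := t) in K; [|lra].
      rewrite <- Rmult_assoc, Rinv_r, Rmult_1_l in K; lra.
  - intros x. pose proof (Hle' 1 x ltac:(lra)) as K. rewrite vscal1 in K. lra.
Qed.

(** Zorn's lemma for the reversed pointwise order. The infimum of a chain is finite, being at least
    [- p (- x)], and is subadditive because any two members of the chain are comparable. *)
Lemma sublinear_minimal (E : Frechet) p :
  sublinear E p ->
  exists q, sublinear E q /\ (forall x, q x <= p x) /\
    forall q', sublinear E q' -> (forall x, q' x <= q x) -> q' = q.
Proof.
  intros Hp.
  set (T := {q : E -> R | sublinear E q /\ forall x, q x <= p x}).
  set (R := fun q r : T => forall x, proj1_sig r x <= proj1_sig q x).
  destruct (zorn T R) as [[q [Hq qp]] Hmax].
  - intros q x. lra.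
  - intros q r s H1 H2 x. specialize (H1 x). specialize (H2 x). lra.
  - intros [q Hq] [r Hr] H1 H2. apply subset_eq_compat.
    apply functional_extensionality. intros x. apply Rle_antisym; [apply H2|apply H1].
  - intros A HA. destruct (classic (exists q, A q)) as [[q0 Aq0]|Hno].
    + destruct (pointwise_inf (fun (q : {q : T | A q}) => proj1_sig (proj1_sig q))
        (exist _ q0 Aq0) (fun x => - p ((-1) [*] x))) as [g [Hle Hglb]].
      { intros [q Aq] x. simpl. pose proof (sublinear_opp E _ x (proj1 (proj2_sig q))).
        pose proof (proj2 (proj2_sig q) ((-1) [*] x)). lra. }
      assert (Hg : sublinear E g).
      { apply sublinear_intro.
        - intros x y.
          assert (g (x [+] y) - g y <= g x); [|lra].
          apply Hglb. intros q1.
          assert (g (x [+] y) - proj1_sig (proj1_sig q1) x <= g y); [|lra].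
          apply Hglb. intros q2.
          destruct (HA _ _ (proj2_sig q1) (proj2_sig q2)) as [H|H].
          + pose proof (Hle q2 (x [+] y)).
            pose proof (proj1 (proj1 (proj2_sig (proj1_sig q2))) x y).
            specialize (H x). lra.
          + pose proof (Hle q1 (x [+] y)).
            pose proof (proj1 (proj1 (proj2_sig (proj1_sig q1))) x y).
            specialize (H y). lra.
        - apply Rle_antisym.
          + rewrite <- (sublinear_0 E (proj1_sig q0) (proj1 (proj2_sig q0))).
            exact (Hle (exist _ q0 Aq0) (v0 E)).
          + apply Hglb. intros q.
            rewrite (sublinear_0 E _ (proj1 (proj2_sig (proj1_sig q)))). lra.
        - intros t x Ht.
          assert (K : / t * g (t [*] x) <= g x).
          { apply Hglb. intros q. pose proof (Hle q (t [*] x)) as K.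
            rewrite (proj2 (proj1 (proj2_sig (proj1_sig q)))) in K by lra.
            apply Rmult_le_compat_l with (r := / t) in K;
              [|left; now apply Rinv_0_lt_compat].
            rewrite <- Rmult_assoc, Rinv_l, Rmult_1_l in K; lra. }
          apply Rmult_le_compat_l with (r := t) in K; [|lra].
          rewrite <- Rmult_assoc, Rinv_r, Rmult_1_l in K; lra. }
      assert (gp : forall x, g x <= p x).
      { intros x. apply Rle_trans with (1 := Hle (exist _ q0 Aq0) x).
        apply (proj2 (proj2_sig q0)). }
      exists (exist _ g (conj Hg gp)). intros q Aq x. exact (Hle (exist _ q Aq) x).
    + exists (exist _ p (conj Hp (fun x => Rle_refl _))). intros q Aq.
      exfalso. apply Hno. now exists q.
  - exists q. split; auto. split; auto. intros q' Hq' Hle.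
    assert (K : forall x, q' x <= p x).
    { intros x. apply Rle_trans with (1 := Hle x). auto. }
    pose proof (Hmax (exist _ q' (conj Hq' K)) Hle) as Heq.
    now apply (f_equal (@proj1_sig _ _)) in Heq.
Qed.

(** Hahn-Banach: a minimal sublinear function cannot be lowered by bending, hence is additive.
    Bending [maxsem E n] at [x0] beforehand forces the value at [- x0] down to [- maxsem E n x0]. *)
Lemma norming_functional (E : Frechet) n (x0 : E) :
  exists f : dual E, (forall x, Rabs (ev E f x) <= maxsem E n x) /\ ev E f x0 = maxsem E n x0.
Proof.
  assert (Hp : sublinear E (maxsem E n)).
  { split; [apply maxsem_triangle|]. intros t x Ht. now rewrite maxsem_homog, Rabs_pos_eq. }
  destruct (sublinear_bend E _ x0 Hp) as [p' [Hp' [Hle Hx0]]].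
  destruct (sublinear_minimal E p' Hp') as [q [Hq [qp Hmin]]].
  assert (add : forall x y, q (x [+] y) = q x + q y).
  { intros x y. apply Rle_antisym; [apply Hq|].
    destruct (sublinear_bend E q y Hq) as [q' [Hq' [H1 H2]]].
    rewrite (Hmin q' Hq' H1) in H2. specialize (H2 x). lra. }
  assert (opp : forall x, q ((-1) [*] x) = - q x).
  { intros x. pose proof (add x ((-1) [*] x)) as K.
    rewrite <- vopp_scal, vaddN, (sublinear_0 E q Hq), vopp_scal in K. lra. }
  assert (lin : is_linear E q).
  { split; auto. intros c x. destruct (Rle_dec 0 c) as [Hc|Hc]; [now apply Hq|].
    replace c with (-1 * - c) at 1 by ring.
    rewrite <- vscalA, opp, (proj2 Hq) by lra. ring. }
  assert (bnd : forall x, Rabs (q x) <= 1 * maxsem E n x).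
  { intros x. rewrite Rmult_1_l. apply Rabs_le. split.
    - pose proof (qp ((-1) [*] x)) as K. pose proof (Hle ((-1) [*] x)) as K'.
      rewrite opp in K. rewrite maxsem_homog in K'.
      replace (-1) with (-(1)) in K' at 2 by lra. rewrite Rabs_Ropp, Rabs_R1 in K'. lra.
    - apply Rle_trans with (1 := qp x). auto. }
  exists (exist _ q (conj lin (ex_intro _ n (ex_intro _ 1 bnd)))). split.
  - intros x. rewrite <- (Rmult_1_l (maxsem E n x)). apply bnd.
  - simpl. apply Rle_antisym.
    + apply Rle_trans with (1 := Rle_abs _). rewrite <- (Rmult_1_l (maxsem E n x0)). apply bnd.
    + pose proof (qp ((-1) [*] x0)) as K. pose proof (Hx0 ((-1) [*] x0)) as K'.
      rewrite vaddC, <- vopp_scal, vaddN, (sublinear_0 E _ Hp), vopp_scal in K'.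
      rewrite opp in K. lra.
Qed.

Lemma dual_separates (E : Frechet) (x : E) : (forall f, ev E f x = 0) -> x = v0 E.
Proof.
  intros H. apply sem_separating. intros n.
  destruct (norming_functional E n x) as [f [_ Hf]]. rewrite H in Hf.
  apply Rle_antisym; [|apply sem_ge0]. rewrite Hf. now apply sem_le_maxsem.
Qed.

(* Gliding hump: the functional [sum_k 3^-k h_k] is unbounded on [K], the sign of
   [h_k] being chosen so that the [k]-th partial sum is large at [x_k]. *)
Lemma weakly_bounded_bounded (E : Frechet) (K : E -> Prop) :
  (forall f, exists M, forall x, K x -> Rabs (ev E f x) <= M) -> E_bounded E K.
Proof.
  intros HK n. apply NNPP. intros Hno.
  assert (unb : forall M, exists x, K x /\ M < maxsem E n x).
  { intros M. apply NNPP. intros H. apply Hno. exists M. intros x Kx.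
    apply Rnot_lt_le. intros Hlt. apply H. exists x. split; auto.
    apply Rlt_le_trans with (1 := Hlt). now apply sem_le_maxsem. }
  (* With ratio 1/3 the weights after the [k]-th add up to half of [w k], so later terms cannot
     cancel the [k]-th hump. *)
  set (w := fun k => (/ 3) ^ k).
  assert (w0 : forall k, 0 < w k) by (intros k; apply pow_lt; lra).
  destruct (choice_fun (fun (kS : nat * dual E) (xh : E * dual E) =>
    K (fst xh) /\ (forall x, Rabs (ev E (snd xh) x) <= maxsem E n x) /\
    4 * INR (S (fst kS)) < w (fst kS) * maxsem E n (fst xh) /\
    w (fst kS) * maxsem E n (fst xh) <=
      Rabs (ev E (daxpy E (w (fst kS)) (snd xh) (snd kS)) (fst xh)))) as [next Hnext].
  { intros [k s]. destruct (unb (4 * INR (S k) / w k)) as [x [Kx Hx]].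
    destruct (norming_functional E n x) as [h [Hh Hhx]].
    assert (Hx' : 4 * INR (S k) < w k * maxsem E n x).
    { apply Rmult_lt_compat_l with (r := w k) in Hx; [|apply w0].
      replace (w k * (4 * INR (S k) / w k)) with (4 * INR (S k)) in Hx; auto.
      field. specialize (w0 k). lra. }
    pose proof (maxsem_ge0 E n x) as P. specialize (w0 k).
    destruct (Rle_dec 0 (ev E s x)) as [Hs|Hs].
    - exists (x, h). simpl. repeat split; auto. rewrite Hhx, Rabs_pos_eq; nra.
    - exists (x, daxpy E (-2) h h). simpl. repeat split; auto.
      + intros y. replace (ev E h y + -2 * ev E h y) with (- ev E h y) by ring.
        rewrite Rabs_Ropp. auto.
      + rewrite Hhx, Rabs_left1; nra. }
  set (s := fix s k := match k with
    | O => dzero E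
    | S k' => daxpy E (w k') (snd (next (k', s k'))) (s k') end).
  assert (step : forall k x, Rabs (ev E (s (S k)) x - ev E (s k) x) <= w k * maxsem E n x).
  { intros k x. simpl.
    match goal with |- Rabs ?t <= _ =>
      replace t with (w k * ev E (snd (next (k, s k))) x) by (simpl; ring) end.
    rewrite Rabs_mult, Rabs_pos_eq by (left; apply w0).
    apply Rmult_le_compat_l; [left; apply w0|]. apply Hnext. }
  (* The factor 3/2 is [1 / (1 - 1/3)]; keeping the difference of weights makes the geometric sum
     telescope in the induction. *)
  assert (tail : forall k j x, Rabs (ev E (s (j + k)%nat) x - ev E (s k) x)
                   <= 3 / 2 * (w k - w (j + k)%nat) * maxsem E n x).
  { intros k j x. induction j as [|j IH].
    - simpl. rewrite !Rminus_diag, Rabs_R0. lra.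
    - replace (ev E (s (S j + k)%nat) x - ev E (s k) x) with
        ((ev E (s (S (j + k))) x - ev E (s (j + k)%nat) x)
         + (ev E (s (j + k)%nat) x - ev E (s k) x)) by (simpl; ring).
      apply Rle_trans with (1 := Rabs_triang _ _).
      specialize (step (j + k)%nat x).
      replace (w (S j + k)%nat) with (/ 3 * w (j + k)%nat) by (unfold w; simpl; ring).
      lra. }
  assert (tail' : forall k j x, (k <= j)%nat ->
    Rabs (ev E (s j) x - ev E (s k) x) <= 3 / 2 * w k * maxsem E n x).
  { intros k j x Hkj. replace j with ((j - k) + k)%nat by lia.
    apply Rle_trans with (1 := tail k (j - k)%nat x).
    apply Rmult_le_compat_r; [apply maxsem_ge0|].
    specialize (w0 (j - k + k)%nat). lra. }
  destruct (choice_fun (fun x l => Un_cv (fun k => ev E (s k) x) l)) as [f Hf].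
  { intros x. destruct (R_complete (fun k => ev E (s k) x)) as [l Hl]; [|now exists l].
    intros eps Heps. pose proof (maxsem_ge0 E n x) as P.
    destruct (pow_lt_1_zero (/ 3)) with (y := eps / (4 * (maxsem E n x + 1))) as [N HN].
    { rewrite Rabs_pos_eq; lra. }
    { apply Rdiv_lt_0_compat; lra. }
    specialize (HN N (le_n N)). fold (w N) in HN.
    rewrite Rabs_pos_eq in HN by (left; apply w0).
    assert (Hb : 3 / 2 * w N * maxsem E n x < eps / 2).
    { apply Rmult_lt_compat_r with (r := 4 * (maxsem E n x + 1)) in HN; [|lra].
      unfold Rdiv in HN. rewrite (Rmult_assoc eps), Rinv_l, Rmult_1_r in HN by lra.
      specialize (w0 N). nra. }
    exists N. intros i j Hi Hj. unfold Rdist.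
    pose proof (tail' N i x ltac:(lia)) as H1. pose proof (tail' N j x ltac:(lia)) as H2.
    rewrite <- (Rabs_Ropp (ev E (s j) x - _)) in H2.
    replace (ev E (s i) x - ev E (s j) x) with
      ((ev E (s i) x - ev E (s N) x) + - (ev E (s j) x - ev E (s N) x)) by ring.
    apply Rle_lt_trans with (1 := Rabs_triang _ _). lra. }
  assert (flim : forall k x, Rabs (f x - ev E (s k) x) <= 3 / 2 * w k * maxsem E n x).
  { intros k x. apply Rle_plus_epsilon. intros eps Heps.
    destruct (Hf x eps Heps) as [N HN]. specialize (HN (N + k)%nat ltac:(lia)).
    specialize (tail' k (N + k)%nat x ltac:(lia)). unfold Rdist in HN.
    rewrite <- Rabs_Ropp in HN.
    replace (f x - ev E (s k) x) with
      (- (ev E (s (N + k)%nat) x - f x) + (ev E (s (N + k)%nat) x - ev E (s k) x)) by ring.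
    apply Rle_trans with (1 := Rabs_triang _ _). lra. }
  assert (lin : is_linear E f).
  { split.
    - intros x y. apply UL_sequence with (fun k => ev E (s k) (x [+] y)); auto.
      pose proof (CV_plus _ _ _ _ (Hf x) (Hf y)) as C.
      intros eps Heps. destruct (C eps Heps) as [N HN]. exists N. intros k Hk.
      rewrite ev_add. auto.
    - intros c x. apply UL_sequence with (fun k => ev E (s k) (c [*] x)); auto.
      assert (Cc : Un_cv (fun _ => c) c).
      { intros eps Heps. exists O. intros k _. unfold Rdist. now rewrite Rminus_diag, Rabs_R0. }
      pose proof (CV_mult _ _ _ _ Cc (Hf x)) as C.
      intros eps Heps. destruct (C eps Heps) as [N HN]. exists N. intros k Hk.
      rewrite ev_scal. auto. }
  assert (bnd : forall x, Rabs (f x) <= 3 / 2 * maxsem E n x).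
  { intros x. specialize (flim O x). simpl in flim. unfold w in flim. simpl in flim.
    rewrite Rminus_0_r, Rmult_1_r in flim. auto. }
  destruct (HK (exist _ f (conj lin (ex_intro _ n (ex_intro _ (3 / 2) bnd))))) as [M HM].
  simpl in HM.
  destruct (INR_above M) as [k Hk].
  destruct (Hnext (k, s k)) as [H1 [H2 [H3 H4]]].
  set (x := fst (next (k, s k))) in *. cbn [fst snd] in H3, H4.
  change (daxpy E (w k) (snd (next (k, s k))) (s k)) with (s (S k)) in H4.
  specialize (flim (S k) x). specialize (HM x H1).
  (* The error [3 / 2 * w (S k)] is half of [w k], so [|f x|] is at least half of the hump and
     exceeds [2 * (k + 1)], hence [M]. *)
  replace (w (S k)) with (/ 3 * w k) in flim by reflexivity.
  rewrite <- Rabs_Ropp in flim.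
  pose proof (Rabs_triang (f x) (- (f x - ev E (s (S k)) x))) as H5.
  replace (f x + - (f x - ev E (s (S k)) x)) with (ev E (s (S k)) x) in H5 by ring.
  rewrite S_INR in H3. pose proof (pos_INR k). lra.
Qed.

(** The sets [|f| < n] form a weakly open cover, so every functional is bounded on [K], and uniform
    boundedness applies. *)
Lemma weakly_compact_bounded (E : Frechet) (K : E -> Prop) :
  Defs.compact E (weak_open E) K -> E_bounded E K.
Proof.
  intros HK. apply weakly_bounded_bounded. intros f.
  destruct (HK (fun U => exists n, U = fun x => Rabs (ev E f x) < INR n)) as [L [HL Hcov]].
  - intros U [n ->]. apply weak_open_ev_lt.
  - intros x _. destruct (INR_above (Rabs (ev E f x))) as [n Hn].
    exists (fun x => Rabs (ev E f x) < INR n). split; auto. now exists n.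
  - assert (B : exists M, forall U, In U L -> forall x, U x -> Rabs (ev E f x) <= M).
    { clear Hcov. induction L as [|U L IH].
      - exists 0. intros U [].
      - destruct IH as [M HM]; [intros V HV; apply HL; now right|].
        assert (HU : exists n, U = fun x => Rabs (ev E f x) < INR n) by (apply HL; now left).
        destruct HU as [n ->]. exists (Rmax M (INR n)). intros V [<-|HV] x Vx.
        + apply Rle_trans with (2 := Rmax_r _ _). lra.
        + apply Rle_trans with (2 := Rmax_l _ _). eauto. }
    destruct B as [M HM]. exists M. intros x Kx. destruct (Hcov x Kx) as [U [HU Ux]]. eauto.
Qed.

(** * From separability of the strong dual to countable k-networks *)

Lemma weak_regular (E : Frechet) : regular_space E (weak_open E).
Proof.
  split.
  - intros x y Hyx.
    assert (K : exists f, ev E f (vsub E y x) <> 0).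
    { apply NNPP. intros H. apply Hyx. apply vsub_eq0, dual_separates. intros f.
      apply NNPP. intros Hf. apply H. now exists f. }
    destruct K as [f Hf]. exists (f :: nil), (Rabs (ev E f (vsub E y x))).
    split; [now apply Rabs_pos_lt|]. intros z Hz ->.
    specialize (Hz f (or_introl eq_refl)).
    rewrite !ev_sub, Rabs_minus_sym in Hz. lra.
  - intros C x HC Cx. destruct (HC x Cx) as [L [r [Hr H]]].
    exists (fun y => exists d, 0 < d /\
      forall f, In f L -> Rabs (ev E f (vsub E y x)) <= r / 2 - d).
    exists (fun y => exists f, In f L /\ r / 2 < Rabs (ev E f (vsub E y x))).
    split; [apply weak_open_open_slab|]. split; [|split; [|split]].
    + intros y [f [Hf Hy]]. exists (f :: nil), (Rabs (ev E f (vsub E y x)) - r / 2).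
      split; [lra|]. intros z Hz. exists f. split; auto.
      specialize (Hz f (or_introl eq_refl)). rewrite !ev_sub in *.
      rewrite Rabs_minus_sym in Hz.
      pose proof (Rabs_triang (ev E f y - ev E f z) (ev E f z - ev E f x)) as T.
      replace (ev E f y - ev E f z + (ev E f z - ev E f x))
        with (ev E f y - ev E f x) in T by ring. lra.
    + exists (r / 2). split; [lra|]. intros f _. rewrite vsub_self, ev_0, Rabs_R0. lra.
    + intros y Cy. apply NNPP. intros Hn. apply (H y); auto. intros f Hf.
      apply Rnot_le_lt. intros Hle. apply Hn. exists f. split; auto. lra.
    + intros y [[d [Hd H1]] [f [Hf H2]]]. specialize (H1 f Hf). lra.
Qed.

(** A piece collects the members of [dball E m] within [e m k / 2] of [s j] on [B m k]. Two members
    of one piece differ by at most [e m k] there, hence by at most [eps] on [C] for a suitable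
    [k]. *)
Lemma strong_dual_countable_network (E : Frechet) :
  density_condition E -> strong_dual_separable E ->
  exists W : nat -> dual E -> Prop, forall f C eps, E_bounded E C -> 0 < eps ->
    exists n, W n f /\ forall g, W n g -> forall x, C x -> Rabs (ev E g x - ev E f x) <= eps.
Proof.
  intros DC [s Hs].
  destruct (density_condition_countable E DC) as [B [e [HBe Hnet]]].
  exists (fun n g => let (m, kj) := Cantor.of_nat n in let (k, j) := Cantor.of_nat kj in
    dball E m g /\
    forall x, B m k x -> Rabs (ev E (s j) x - ev E g x) <= e m k / 2).
  intros f C eps HC Heps.
  destruct (dball_ex E f) as [m Hm].
  destruct (Hnet m C eps HC Heps) as [k Hk]. destruct (HBe m k) as [HB He].
  destruct (Hs _ (strong_open_sup_lt E (B m k) f (e m k / 2) HB)) as [j Hj].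
  { exists f, 0. split; [lra|]. intros x _. rewrite Rminus_diag, Rabs_R0. lra. }
  destruct Hj as [d [Hd Hj]].
  assert (Hf : forall x, B m k x -> Rabs (ev E (s j) x - ev E f x) <= e m k / 2).
  { intros x Bx. specialize (Hj x Bx). lra. }
  exists (Cantor.to_nat (m, Cantor.to_nat (k, j))). rewrite !Cantor.cancel_of_to.
  split; auto. intros g [Bg Hg]. apply Hk; auto. intros x Bx.
  specialize (Hf x Bx). specialize (Hg x Bx). rewrite Rabs_minus_sym in Hg.
  pose proof (Rabs_triang (ev E g x - ev E (s j) x) (ev E (s j) x - ev E f x)) as T.
  replace (ev E g x - ev E (s j) x + (ev E (s j) x - ev E f x))
    with (ev E g x - ev E f x) in T by ring. lra.
Qed.

Theorem dual_separable_weakly_aleph0 (E : Frechet) :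
  density_condition E -> strong_dual_separable E -> weakly_aleph0_space E.
Proof.
  intros DC Hsep. split; [apply weak_regular|].
  destruct (strong_dual_countable_network E DC Hsep) as [W HW].
  destruct nat_lists_countable as [dec Hdec]. destruct dense_sequence as [q Hq].
  (* With [r = / INR (S m)], the factor 3/4 is 1/2 for the neighbourhood of [x], 1/8 for the
     variation over [W n] and 1/8 for replacing [f x] by [q i]. Conversely a point of the slab
     satisfies [|f y - f x| <= 7 / 8 * r < eps]. *)
  set (slab := fun t (y : E) => let (n, im) := Cantor.of_nat t in
    let (i, m) := Cantor.of_nat im in
    forall g, W n g -> Rabs (ev E g y - q i) <= 3 / 4 * / INR (S m)).
  set (net := fun n (y : E) => forall t, In t (dec n) -> slab t y).
  exists (fun S => exists n, net n = S). split; [|now exists net].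
  intros K U HK HU KU.
  assert (HB := weakly_compact_bounded E K HK).
  (* A set [net n] need not be a weak neighbourhood, since [W n] may be infinite. The cover
     therefore consists of open sets [V] whose trace on [K] lies in a [net n] inside [U]. *)
  set (cov := fun V : E -> Prop => weak_open E V /\
    exists n, (forall y, K y -> V y -> net n y) /\ forall y, net n y -> U y).
  destruct (HK cov) as [L [HL Hcov]].
  - now intros V [HV _].
  - intros x Kx. destruct (HU x (KU x Kx)) as [L [eps [Heps H]]].
    destruct (archimed_cor1 eps Heps) as [m [Hm Hm0]]. destruct m as [|m]; [lia|].
    set (r := / INR (S m)) in *.
    assert (Hr : 0 < r) by (apply Rinv_0_lt_compat, lt_0_INR; lia).
    set (V := fun y => exists d, 0 < d /\
                forall f, In f L -> Rabs (ev E f (vsub E y x)) <= r / 2 - d).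
    assert (N : exists l, (forall y, K y -> V y -> forall t, In t l -> slab t y) /\
      forall y, (forall t, In t l -> slab t y) ->
        forall f, In f L -> Rabs (ev E f (vsub E y x)) < eps).
    { assert (VL : forall y, V y -> forall f, In f L -> Rabs (ev E f (vsub E y x)) <= r / 2).
      { intros y [d [Hd Hy]] f Hf. specialize (Hy f Hf). lra. }
      clearbody V. clear H. induction L as [|f L IH].
      - exists nil. split; intros; contradiction.
      - destruct IH as [l [Hl1 Hl2]]; [intros y Vy g Hg; apply VL; auto; now right|].
        destruct (HW f K (r / 8) HB ltac:(lra)) as [n [Wf Hn]].
        destruct (Hq (ev E f x) (r / 8) ltac:(lra)) as [i Hi].
        set (t := Cantor.to_nat (n, Cantor.to_nat (i, m))).
        assert (Ht : forall y, slab t y <-> forall g, W n g -> Rabs (ev E g y - q i) <= 3 / 4 * r).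
        { intros y. unfold slab, t. rewrite !Cantor.cancel_of_to. reflexivity. }
        apply Rabs_def2 in Hi.
        exists (t :: l). split.
        + intros y Ky Vy t' [<-|Ht']; [|now apply (Hl1 y)].
          apply Ht. intros g Wg. specialize (Hn g Wg y Ky).
          specialize (VL y Vy f (or_introl eq_refl)). rewrite ev_sub in VL.
          pose proof (Rabs_triang (ev E g y - ev E f y) (ev E f y - ev E f x)) as T1.
          pose proof (Rabs_triang (ev E g y - ev E f y + (ev E f y - ev E f x))
                        (ev E f x - q i)) as T2.
          assert (Rabs (ev E f x - q i) <= r / 8) by (apply Rabs_le; lra).
          replace (ev E g y - ev E f y + (ev E f y - ev E f x) + (ev E f x - q i))
            with (ev E g y - q i) in T2 by ring. lra.
        + intros y Hy g [<-|Hg].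
          * assert (Hf := proj1 (Ht y) (Hy t (or_introl eq_refl)) f Wf).
            rewrite ev_sub.
            pose proof (Rabs_triang (ev E f y - q i) (q i - ev E f x)) as T.
            assert (Rabs (q i - ev E f x) <= r / 8) by (apply Rabs_le; lra).
            replace (ev E f y - q i + (q i - ev E f x)) with (ev E f y - ev E f x) in T by ring.
            lra.
          * apply Hl2; auto. intros t' Ht'. apply Hy. now right. }
    destruct N as [l [Hl1 Hl2]]. destruct (Hdec l) as [n Hn].
    exists V. split; [split|].
    + apply weak_open_open_slab.
    + exists n. unfold net. rewrite Hn. split; auto.
    + exists (r / 2). split; [lra|]. intros f _. rewrite vsub_self, ev_0, Rabs_R0. lra.
  - assert (F : exists F : list (E -> Prop), (forall S, In S F -> exists n, net n = S) /\
      (forall V, In V L -> forall y, K y -> V y -> exists S, In S F /\ S y) /\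
      forall S, In S F -> forall y, S y -> U y).
    { clear Hcov. induction L as [|V L IH].
      - exists nil. repeat split; intros; contradiction.
      - destruct IH as [F [F1 [F2 F3]]]; [intros V' H'; apply HL; now right|].
        destruct (HL V (or_introl eq_refl)) as [_ [n [H1 H2]]].
        exists (net n :: F). split; [|split].
        + intros S [<-|HS]; [now exists n|auto].
        + intros V' [<-|HV'] y Ky Vy.
          * exists (net n). split; [now left|auto].
          * destruct (F2 V' HV' y Ky Vy) as [S [HS Sy]]. exists S. split; [now right|auto].
        + intros S [<-|HS]; auto. now apply F3. }
    destruct F as [F [F1 [F2 F3]]]. exists F. split; auto. split; auto.
    intros x Kx. destruct (Hcov x Kx) as [V [HV Vx]]. eauto.
Qed.

(** A countable family is a union of families with at most one member, and these are locally finite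
    with the whole space as neighbourhood. *)
Lemma aleph0_aleph (X : Type) (op : (X -> Prop) -> Prop) :
  op (fun _ => True) -> aleph0_space X op -> aleph_space X op.
Proof.
  intros HT [Hreg [N [HN [g Hg]]]]. split; auto. exists N. split; auto.
  exists (fun k S => N S /\ g k = S). split.
  - intros k x. exists (fun _ => True). split; auto. split; auto.
    exists (g k :: nil). intros S [_ HS] _. now left.
  - intros S. split.
    + intros HS. destruct (Hg S HS) as [k Hk]. now exists k.
    + now intros [k [HS _]].
Qed.

Theorem theorem5p7 (E : Frechet) :
  ~ contains_l1 E -> density_condition E ->
  (weakly_aleph_space E <-> weakly_aleph0_space E) /\
  (weakly_aleph0_space E <-> strong_dual_separable E).
Proof.
  intros Nl1 DC.
  assert (ba : weakly_aleph0_space E -> weakly_aleph_space E).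
  { apply aleph0_aleph. intros x _. exists nil, 1. split; [lra|auto]. }
  assert (ac := weakly_aleph_dual_separable E Nl1 DC).
  assert (cb := dual_separable_weakly_aleph0 E DC).
  tauto.
Qed.
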